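(* Let $X,Y,Z,P$ be Asplund spaces, $K\subset Z$ a closed convex pointed cone with $\operatorname{int}K\ne\emptyset$, $g:X\times P\to Z$ a map, $H:X\times P\rightrightarrows Y$ a set-valued map with closed graph, and $S(p)=\{x\in X\mid 0\in H(x,p)\}$, $\operatorname{Gr}S=\{(p,x)\mid x\in S(p)\}$. Let $(\overline{x},\overline{p})\in X\times P$ and $L>0$. Suppose: (1) $g$ is $L$-strictly Lipschitz at $(\overline{x},\overline{p})$: $g$ is strictly Lipschitz at $(\overline{x},\overline{p})$ and $\|g(x,p)-g(u,q)\|\le L(\|x-u\|+\|p-q\|)$ for $(x,p),(u,q)$ in a neighborhood of $(\overline{x},\overline{p})$; (2) $(\overline{x},\overline{p})$ is a local weak solution of ''minimize $g(x,p)$ subject to $0\in H(x,p)$'': $0\in H(\overline{x},\overline{p})$ and there exist neighborhoods $U$ of $\overline{x}$, $W$ of $\overline{p}$ with $g(x,p)-g(\overline{x},\overline{p})\notin-\operatorname{int}K$ for all $(x,p)\in U\times W$ with $0\in H(x,p)$; (3) there exists $r>0$ such that $d((p,x),\operatorname{Gr}S)\le r\,d((x,p,0),\operatorname{Gr}H)$ for all $(x,p)$ in a neighborhood of $(\overline{x},\overline{p})$. Then for every $e\in\operatorname{int}K$ there exist $z^*\in K^*$ with $z^*(e)=1$ and $y^*\in Y^*$ such that \[ (0,0)\in\partial(z^*\circ g)(\overline{x},\overline{p})+D_N^*H((\overline{x},\overline{p}),0)(y^* ). \]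
   Context: Products carry the sum norm; $d(z,A)=\inf_{a\in A}\|z-a\|$, $d(z,\emptyset)=\infty$. $K^*=\{z^*\in Z^*\mid z^*(z)\ge0\ \forall z\in K\}$. A map $h:W\to Z$ is strictly Lipschitz at $\overline{w}$ if it is Lipschitz around $\overline{w}$ and there is a neighborhood $V_0$ of $0$ in $W$ such that $(t_k^{-1}(h(w_k+t_kv)-h(w_k)))_k$ has a norm convergent subsequence whenever $v\in V_0$, $w_k\to\overline{w}$, $t_k\downarrow0$. For $\Omega$ in an Asplund space and $\overline{x}\in\Omega$: Fréchet normal cone $\widehat N(\Omega,x)=\{x^*\mid\limsup_{u\to x,u\in\Omega}\frac{x^*(u-x)}{\|u-x\|}\le0\}$; limiting normal cone $N(\Omega,\overline{x})$ is the set of $w^*$-limits of $x_n^*\in\widehat N(\Omega,x_n)$ with $x_n\to\overline{x}$, $x_n\in\Omega$. Limiting subdifferential $\partial\varphi(\overline{x})=\{x^*\mid(x^*,-1)\in N(\operatorname{epi}\varphi,(\overline{x},\varphi(\overline{x})))\}$. Normal coderivative of $F$ at $(w,y)\in\operatorname{Gr}F$: $D_N^*F(w,y)(y^* )=\{w^*\mid(w^*,-y^* )\in N(\operatorname{Gr}F,(w,y))\}$. *)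

(* Defs.v *)
From HB Require Import structures.
From mathcomp Require Import all_boot all_order all_algebra.
From mathcomp Require Import all_classical all_reals all_analysis.
Set Implicit Arguments. Unset Strict Implicit. Unset Printing Implicit Defensive.
Import Order.TTheory GRing.Theory Num.Theory.
Import numFieldNormedType.Exports.
Local Open Scope classical_set_scope.
Local Open Scope ring_scope.

Definition nrm (R : realType) (V : normedModType R) : V -> R := fun x => `|x|.

Definition is_dual (R : realType) (V : normedModType R) (f : V -> R) : Prop :=
  (forall (a : R) (u v : V), f (a *: u + v) = a * f u + f v) /\ continuous f.

Definition sum_norm (R : realType) (V W : normedModType R)
  (n1 : V -> R) (n2 : W -> R) : V * W -> R := fun z => n1 z.1 + n2 z.2.

(** Asplund: every separable linear subspace M has separable dual M^*.
    Dual of M: linear functionals on M bounded on M; dual-norm distance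
    <= eps is expressed as |f m - phi m| <= eps ||m|| on M. *)
Definition subspace (R : realType) (V : normedModType R) (M : set V) : Prop :=
  M 0 /\ forall (a : R) (u v : V), M u -> M v -> M (a *: u + v).
Definition separable_in (R : realType) (V : normedModType R) (M : set V) : Prop :=
  exists d : nat -> V, (forall n, M (d n)) /\
    forall m, M m -> forall eps : R, 0 < eps -> exists n, `|m - d n| < eps.
Definition dual_on (R : realType) (V : normedModType R) (M : set V) (f : V -> R) :=
  (forall (a : R) (u v : V), M u -> M v -> f (a *: u + v) = a * f u + f v) /\
  exists C : R, forall m, M m -> `|f m| <= C * `|m|.
Definition separable_dual (R : realType) (V : normedModType R) (M : set V) : Prop :=
  exists phi : nat -> V -> R, (forall n, dual_on M (phi n)) /\
    forall f, dual_on M f -> forall eps : R, 0 < eps ->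
      exists n, forall m, M m -> `|f m - phi n m| <= eps * `|m|.
Definition asplund (R : realType) (V : completeNormedModType R) : Prop :=
  forall M : set V, subspace M -> separable_in M -> separable_dual M.

(** Fréchet normal cone w.r.t. a norm [nrm] (limsup <= 0 unfolded). *)
Definition frechet_normal (R : realType) (V : normedModType R) (nV : V -> R)
  (A : set V) (x : V) (xs : V -> R) : Prop :=
  A x /\ is_dual xs /\
  forall eps : R, 0 < eps -> exists delta : R, 0 < delta /\
    forall u, A u -> nV (u - x) < delta -> xs (u - x) <= eps * nV (u - x).

Definition limiting_normal (R : realType) (V : normedModType R) (nV : V -> R)
  (A : set V) (xb : V) (xs : V -> R) : Prop :=
  A xb /\ is_dual xs /\
  exists (x : nat -> V) (xsn : nat -> V -> R),
    (forall n, A (x n)) /\ x @ \oo --> xb /\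
    (forall n, frechet_normal nV A (x n) (xsn n)) /\
    forall v, (fun n => xsn n v) @ \oo --> xs v.

Definition epi (R : realType) (V : normedModType R) (phi : V -> R) : set (V * R) :=
  [set z | phi z.1 <= z.2].
Definition limiting_subdiff (R : realType) (V : normedModType R) (nV : V -> R)
  (phi : V -> R) (xb : V) (xs : V -> R) : Prop :=
  limiting_normal (sum_norm nV (@nrm R R^o)) (epi phi) (xb, phi xb)
    (fun z => xs z.1 - z.2).

Definition graph (R : realType) (W Y : normedModType R) (F : W -> set Y) : set (W * Y) :=
  [set z | F z.1 z.2].
Definition normal_coderiv (R : realType) (W Y : normedModType R)
  (nW : W -> R) (nY : Y -> R) (F : W -> set Y) (w : W) (y : Y)
  (ys : Y -> R) (ws : W -> R) : Prop :=
  limiting_normal (sum_norm nW nY) (graph F) (w, y) (fun z => ws z.1 - ys z.2).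

(** Distance (extended real, d(z, empty) = +oo). *)
Definition dist (R : realType) (V : normedModType R) (nV : V -> R)
  (z : V) (A : set V) : \bar R :=
  ereal_inf [set (nV (z - a))%:E | a in A].

Definition convex_cone (R : realType) (Z : normedModType R) (K : set Z) : Prop :=
  K 0 /\ (forall (t : R) u, 0 <= t -> K u -> K (t *: u)) /\
  (forall u v, K u -> K v -> K (u + v)).
Definition pointed (R : realType) (Z : normedModType R) (K : set Z) : Prop :=
  forall u, K u -> K (- u) -> u = 0.
Definition dual_cone (R : realType) (Z : normedModType R) (K : set Z) : set (Z -> R) :=
  [set zs | is_dual zs /\ forall z, K z -> 0 <= zs z].

Definition strictly_lipschitz (R : realType) (W Z : normedModType R)
  (nW : W -> R) (h : W -> Z) (wb : W) : Prop :=
  (exists (C : R) (N : set W), nbhs wb N /\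
     forall a b, N a -> N b -> `|h a - h b| <= C * nW (a - b)) /\
  exists V0 : set W, nbhs (0 : W) V0 /\
    forall v, V0 v -> forall (w : nat -> W) (t : nat -> R),
      w @ \oo --> wb -> (forall k, 0 < t k) -> t @ \oo --> (0 : R) ->
      exists (phi : nat -> nat) (l : Z), (forall k, (phi k < phi k.+1)%N) /\
        (fun k => (t (phi k))^-1 *: (h (w (phi k) + t (phi k) *: v) - h (w (phi k))))
          @ \oo --> l.

(* Main.v *)
(** The Gerstewitz functional [s] of [e] scalarizes the problem: [s (g w - g wb)]
    is nonnegative on the feasible set near [wb], and by the metric estimate this
    becomes nonnegativity of [s (g w - g wb) + D (|w - u| + |y|)] for all [w] near
    [wb] and all [(u, y)] in the graph of [H].  So a sublinear functional of the
    displacement from [((wb, g wb), (wb, 0))] is minimal there over the product of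
    the graphs of [g] and [H].

    The key fact is a fuzzy multiplier rule: if [N (x - xb) >= 0] on a closed set
    [A] of an Asplund space near [xb], there are Frechet normals [xs] to [A] at
    points arbitrarily close to [xb] with [- xs <= N + mu |.|].  On a closed
    separable subspace [M] with separable dual, [N] and the norm are uniform limits
    of functions that are Frechet superdifferentiable everywhere, and a
    Borwein-Preiss iteration with these functions gives the rule.  By Hahn-Banach
    the existence of [xs] amounts to inequalities over finite families of points
    of [A]; a countable set of witnesses detects every violated one, so [M] can be
    chosen such that a normal relative to [M] yields a normal in the whole space.

    The rule also yields weak* sequential compactness of dual balls and a fuzzy sum
    rule for Frechet subgradients.  Passing to the limit in the multipliers,
    [- xs <= N + mu |.|] splits into [zs <= s] (so [zs] is in the dual cone and
    [zs e = 1]) and [a + b = 0].  The sum rule replaces the varying functionals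
    [zn \o g] by the limit [zs \o g]: strict Lipschitz continuity makes the
    subgradients of [(zn - zs) \o g] tend to [0]. *)

Require Import Defs.
From HB Require Import structures.
From mathcomp Require Import all_boot all_order all_algebra.
From mathcomp Require Import all_classical all_reals all_analysis.
From mathcomp Require Import ring lra.
Import Order.TTheory GRing.Theory Num.Theory.
Import numFieldNormedType.Exports.
Local Open Scope classical_set_scope.
Local Open Scope ring_scope.
Set Implicit Arguments. Unset Strict Implicit. Unset Printing Implicit Defensive.

(** * Sublinear functionals and the Hahn-Banach theorem *)

Definition sublinear (R : realType) (V : lmodType R) (p : V -> R) : Prop :=
  (forall u v, p (u + v) <= p u + p v) /\
  (forall t u, 0 <= t -> p (t *: u) = t * p u).

Definition convex_cone_rel (R : realType) (V : lmodType R) (G : V -> R -> Prop) :=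
  [/\ G 0 0, forall u r v s, G u r -> G v s -> G (u + v) (r + s)
    & forall t u r, 0 <= t -> G u r -> G (t *: u) (t * r)].

Section LinearForm.
Variables (R : realType) (V : lmodType R) (f : V -> R).
Hypothesis lf : scalar f.

Lemma linear_formB u v : f (u - v) = f u - f v.
Proof. exact: (zmod_morphism_linear lf). Qed.

Lemma linear_form0 : f 0 = 0.
Proof. by rewrite -(subrr 0) linear_formB subrr. Qed.

Lemma linear_formN u : f (- u) = - f u.
Proof. by rewrite -sub0r linear_formB linear_form0 sub0r. Qed.

Lemma linear_formD u v : f (u + v) = f u + f v.
Proof. by rewrite -[v in LHS]opprK linear_formB linear_formN opprK. Qed.

Lemma linear_formZ a u : f (a *: u) = a * f u.
Proof. exact: (scalable_linear lf). Qed.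

End LinearForm.

Section InfSupImage.
Variables (R : realType) (T : Type) (A : set T) (F : T -> R).

Lemma inf_image_le b x : (forall y, A y -> b <= F y) -> A x ->
  inf [set F y | y in A] <= F x.
Proof.
move=> lb Ax; apply: ge_inf; last by exists x.
by exists b => _ [y Ay <-]; exact: lb.
Qed.

Lemma le_inf_image b : A !=set0 -> (forall y, A y -> b <= F y) ->
  b <= inf [set F y | y in A].
Proof.
move=> [x Ax] lb; apply: lb_le_inf; first by exists (F x), x.
by move=> _ [y Ay <-]; exact: lb.
Qed.

Lemma le_sup_image b x : (forall y, A y -> F y <= b) -> A x ->
  F x <= sup [set F y | y in A].
Proof.
move=> ub Ax; apply: ub_le_sup; last by exists x.
by exists b => _ [y Ay <-]; exact: ub.
Qed.

Lemma sup_image_le b : A !=set0 -> (forall y, A y -> F y <= b) ->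
  sup [set F y | y in A] <= b.
Proof.
move=> [x Ax] ub; apply: ge_sup; first by exists (F x), x.
by move=> _ [y Ay <-]; exact: ub.
Qed.

End InfSupImage.

Section Sublinear.
Variables (R : realType) (V : lmodType R).
Implicit Types p q : V -> R.

Lemma sublinear0 p : sublinear p -> p 0 = 0.
Proof. by move=> [_ pZ]; rewrite -(scale0r 0) pZ // mul0r. Qed.

Lemma sublinear_oppr_ge p u : sublinear p -> - p (- u) <= p u.
Proof.
by move=> sp; have := sp.1 u (- u); rewrite subrr sublinear0 // -lerBlDr sub0r.
Qed.

Lemma subadditive_sublinear p : p 0 = 0 ->
    (forall u v, p (u + v) <= p u + p v) ->
    (forall t u, 0 < t -> p (t *: u) <= t * p u) ->
  sublinear p.
Proof.
move=> p0 pD pZ; split=> // t u.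
rewrite le_eqVlt => /orP[/eqP <-|t0]; first by rewrite scale0r mul0r.
apply/eqP; rewrite eq_le pZ //= -(ler_pM2l (_ : 0 < t^-1)) ?invr_gt0 //.
rewrite mulKf ?gt_eqF //; apply: le_trans (pZ _ _ _); last by rewrite invr_gt0.
by rewrite scalerA mulVf ?gt_eqF // scale1r.
Qed.

Lemma sublinearD p q : sublinear p -> sublinear q ->
  sublinear (fun x => p x + q x).
Proof.
move=> [pD pZ] [qD qZ]; split=> [u v|t u t0]; last by rewrite pZ // qZ // mulrDr.
by rewrite addrACA lerD.
Qed.

Lemma sublinearZ p (c : R) : 0 <= c -> sublinear p -> sublinear (fun x => c * p x).
Proof.
move=> c0 [pD pZ]; split=> [u v|t u t0]; last by rewrite pZ // mulrCA.
by rewrite -mulrDr ler_wpM2l.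
Qed.

Lemma scalar_sublinear p : scalar p -> sublinear p.
Proof.
by move=> lp; split=> [u v|t u _]; rewrite ?(linear_formD lp) ?(linear_formZ lp).
Qed.

Lemma sublinear_comp (W : lmodType R) (L : {linear W -> V}) p :
  sublinear p -> sublinear (p \o L).
Proof.
by move=> [pD pZ]; split=> [u v|t u t0] /=; rewrite ?linearD ?linearZ_LR ?pZ.
Qed.

Lemma chain_inf_sublinear (A : set (V -> R)) (b : V -> R) : A !=set0 ->
    (forall p, A p -> sublinear p) -> (forall p x, A p -> b x <= p x) ->
    (forall p q, A p -> A q -> (forall x, p x <= q x) \/ (forall x, q x <= p x)) ->
  sublinear (fun x => inf [set p x | p in A]).
Proof.
move=> [p0 Ap0] sA bA totA; set m := fun x => _.
have m_le p x : A p -> m x <= p x.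
  move=> Ap; apply: (@inf_image_le _ _ _ (fun p : V -> R => p x) (b x)) => // q Aq.
  exact: bA.
have le_m x c : (forall p, A p -> c <= p x) -> c <= m x.
  by move=> h; apply: le_inf_image => //; exists p0.
apply: subadditive_sublinear => [|u v|t u t0].
- apply/eqP; rewrite eq_le; apply/andP; split.
    by rewrite -(sublinear0 (sA _ Ap0)) m_le.
  by apply: le_m => p /sA/sublinear0 ->.
- rewrite -lerBlDr; apply/le_m => p Ap.
  rewrite lerBlDr -lerBlDl; apply/le_m => q Aq; rewrite lerBlDl.
  have [pq|qp] := totA _ _ Ap Aq.
    by apply: le_trans (m_le _ _ Ap) (le_trans ((sA _ Ap).1 u v) _); rewrite lerD2l.
  by apply: le_trans (m_le _ _ Aq) (le_trans ((sA _ Aq).1 u v) _); rewrite lerD2r.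
- rewrite mulrC -ler_pdivrMr //; apply/le_m => p Ap.
  by rewrite ler_pdivrMr // mulrC -((sA _ Ap).2 _ _ (ltW t0)) m_le.
Qed.

Lemma minimal_sublinear p : sublinear p -> exists q,
  [/\ sublinear q, forall x, q x <= p x &
      forall q', sublinear q' -> (forall x, q' x <= q x) -> q' = q].
Proof.
move=> sp; pose T := {q : V -> R | sublinear q /\ forall x, q x <= p x}.
pose ge (a b : T) := `[< forall x, sval b x <= sval a x >].
pose p_T : T := exist _ p (conj sp (fun x => lexx _)).
have [||| q qmin] := @ZL_preorder T p_T ge.
- by move=> a; apply/asboolP => x.
- move=> a b c /asboolP ba /asboolP ac; apply/asboolP => x.
  exact: le_trans (ac x) (ba x).
- move=> A totA; have [A0|] := pselect (A !=set0); last first.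
    by move=> A0; exists p_T => a Aa; case: A0; exists a.
  pose A' := sval @` A; pose m x := inf [set a x | a in A'].
  have lbA a x : A' a -> - p (- x) <= a x.
    move=> [a' _ <-]; have [sa ap] := svalP a'.
    by apply: le_trans (sublinear_oppr_ge _ sa); rewrite lerN2.
  have sm : sublinear m.
    apply: (@chain_inf_sublinear A' (fun x => - p (- x))) => //.
    - by have [a Aa] := A0; exists (sval a), a.
    - by move=> _ [a _ <-]; exact: (svalP a).1.
    - move=> _ _ [a Aa <-] [b Ab <-].
      by have [/asboolP|/asboolP] := totA _ _ Aa Ab; [right|left].
  have m_le a x : A a -> m x <= sval a x.
    move=> Aa; apply: (@inf_image_le _ _ _ (fun a : V -> R => a x) (- p (- x))).
      by move=> b; exact: lbA.
    by exists a.
  have m_le_p x : m x <= p x.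
    by have [a Aa] := A0; apply: le_trans (m_le _ _ Aa) ((svalP a).2 x).
  by exists (exist _ m (conj sm m_le_p)) => a Aa; apply/asboolP => x; exact: m_le.
have [sq q_le_p] := svalP q; exists (sval q); split=> // q' sq' q'q.
have q'_le_p x : q' x <= p x := le_trans (q'q x) (q_le_p x).
have /qmin/asboolP qq' : ge q (exist _ q' (conj sq' q'_le_p)) by exact/asboolP.
by apply/funext => x; apply/eqP; rewrite eq_le q'q qq'.
Qed.

End Sublinear.

Section ConeInf.
Variables (R : realType) (V : lmodType R) (p : V -> R) (G : V -> R -> Prop).
Hypotheses (sp : sublinear p) (cG : convex_cone_rel G).
Hypothesis pG : forall c r, G c r -> 0 <= p c + r.

Definition cone_inf (h : V) : R :=
  inf [set p (h + z.1) + z.2 | z in [set z : V * R | G z.1 z.2]].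

Lemma cone_inf_le h c r : G c r -> cone_inf h <= p (h + c) + r.
Proof.
move=> Gcr; apply: (@inf_image_le _ _ _ (fun z : V * R => p (h + z.1) + z.2)
  (- p (- h)) (c, r)) => //= -[d s] /= /pG pds; have := sp.1 (h + d) (- h).
by rewrite addrAC subrr add0r; lra.
Qed.

Lemma le_cone_inf h b : (forall c r, G c r -> b <= p (h + c) + r) ->
  b <= cone_inf h.
Proof.
move=> hb; apply: le_inf_image; first by exists (0, 0) => /=; case: cG.
by move=> [c r] /= Gcr; exact: hb.
Qed.

Lemma cone_inf_le_sublinear h : cone_inf h <= p h.
Proof. by have [G0 _ _] := cG; have := cone_inf_le h G0; rewrite !addr0. Qed.

Lemma cone_inf_sublinear : sublinear cone_inf.
Proof.
have [G0 GD GZ] := cG; apply: subadditive_sublinear => [|u v|t u t0].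
- apply/eqP; rewrite eq_le -{1}(sublinear0 sp) cone_inf_le_sublinear /=.
  by apply: le_cone_inf => c r Gcr; rewrite add0r; exact: pG.
- rewrite -lerBlDr; apply: le_cone_inf => c r Gcr.
  rewrite lerBlDr -lerBlDl; apply: le_cone_inf => d s Gds.
  rewrite lerBlDl; apply: (le_trans (cone_inf_le _ (GD _ _ _ _ Gcr Gds))).
  by have := sp.1 (u + c) (v + d); rewrite addrACA; lra.
- rewrite mulrC -ler_pdivrMr //; apply: le_cone_inf => c r Gcr.
  rewrite ler_pdivrMr //.
  have := cone_inf_le (t *: u) (GZ _ _ _ (ltW t0) Gcr).
  by rewrite -scalerDr (sp.2 _ _ (ltW t0)) -mulrDr mulrC.
Qed.

End ConeInf.

Section HahnBanach.
Variables (R : realType) (V : lmodType R).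
Implicit Types (p f : V -> R) (G : V -> R -> Prop).

Definition ray_rel p x (c : V) (r : R) : Prop :=
  exists2 t : R, 0 <= t & c = t *: x /\ r = - (t * p x).

Lemma ray_rel_cone p x : convex_cone_rel (ray_rel p x).
Proof.
split.
- by exists 0; rewrite // scale0r mul0r oppr0.
- move=> _ _ _ _ [t t0 [-> ->]] [s s0 [-> ->]]; exists (t + s).
    exact: addr_ge0.
  by rewrite scalerDl mulrDl opprD.
- move=> t _ _ t0 [s s0 [-> ->]]; exists (t * s); first exact: mulr_ge0.
  by rewrite scalerA mulrN mulrA.
Qed.

Lemma ray_rel_self p x : ray_rel p x x (- p x).
Proof. by exists 1; rewrite // scale1r mul1r. Qed.

Lemma ray_rel_ge0 p x c r : sublinear p -> ray_rel p x c r -> 0 <= p c + r.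
Proof. by move=> sp [t t0 [-> ->]]; rewrite sp.2 // subrr. Qed.

Lemma Hahn_Banach p : sublinear p ->
  exists2 f, scalar f & forall x, f x <= p x.
Proof.
move=> /minimal_sublinear[q [sq qp qmin]]; exists q => //.
have qD x y : q (x + y) = q x + q y.
  apply/eqP; rewrite eq_le sq.1 /=.
  have cG := ray_rel_cone q y; have qG c r := @ray_rel_ge0 q y c r sq.
  have := qmin _ (cone_inf_sublinear sq cG qG) (cone_inf_le_sublinear sq cG qG).
  move=> /(congr1 (fun k => k x)) <-.
  by have := cone_inf_le sq qG x (ray_rel_self q y); lra.
have qN x : q (- x) = - q x.
  by apply/eqP; rewrite -addr_eq0 -qD addrC subrr sublinear0.
move=> a u v; rewrite qD; congr (_ + _).
have [a0|a0] := leP 0 a; first exact: sq.2.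
have := sq.2 (- a) u; rewrite oppr_ge0 => /(_ (ltW a0)).
by rewrite scaleNr qN mulNr => /oppr_inj.
Qed.

Lemma Hahn_Banach_cone p G : sublinear p -> convex_cone_rel G ->
    (forall c r, G c r -> 0 <= p c + r) ->
  exists f, [/\ scalar f, forall x, f x <= p x & forall c r, G c r -> - r <= f c].
Proof.
move=> sp cG pG; have [f lf fp] := Hahn_Banach (cone_inf_sublinear sp cG pG).
exists f; split=> // [x|c r Gcr].
  exact: le_trans (fp x) (cone_inf_le_sublinear sp cG pG x).
have := le_trans (fp (- c)) (cone_inf_le sp pG (- c) Gcr).
by rewrite (linear_formN lf) addNr sublinear0 //; lra.
Qed.

Lemma Hahn_Banach_support p x : sublinear p ->
  exists f, [/\ scalar f, forall y, f y <= p y & f x = p x].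
Proof.
move=> sp; have pG c r := @ray_rel_ge0 p x c r sp.
have [f [lf fp fG]] := Hahn_Banach_cone sp (ray_rel_cone p x) pG.
exists f; split=> //; apply/eqP; rewrite eq_le fp /=.
by have := fG _ _ (ray_rel_self p x); rewrite opprK.
Qed.

End HahnBanach.

(** * Bounded linear forms *)

Definition norm_dominated (R : realType) (V : normedModType R) (C : R)
  (p : V -> R) : Prop := forall x, p x <= C * `|x|.

Section NormDominated.
Variables (R : realType) (V : normedModType R).
Implicit Types (p f : V -> R) (C : R).

Lemma norm_sublinear : sublinear (fun x : V => `|x|).
Proof. by split=> [u v|t u t0]; [exact: ler_normD|rewrite normrZ ger0_norm]. Qed.

Lemma norm_dominatedW C D p : C <= D -> norm_dominated C p -> norm_dominated D p.
Proof. by move=> CD pC x; apply: le_trans (pC x) _; rewrite ler_wpM2r. Qed.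

Lemma norm_dominated_abs f C : scalar f -> norm_dominated C f ->
  forall x, `|f x| <= C * `|x|.
Proof.
move=> lf fC x; rewrite ler_norml fC andbT lerNl -(linear_formN lf).
by apply: le_trans (fC _) _; rewrite normrN.
Qed.

Lemma lipschitz_at_continuous (W : normedModType R) (h : V -> W) C x :
  (\forall y \near x, `|h y - h x| <= C * `|y - x|) -> {for x, continuous h}.
Proof.
move=> hC; apply/cvgrPdist_le => e e0; near=> y; rewrite distrC.
apply: (@le_trans _ _ ((`|C| + 1) * `|y - x|)).
  apply: le_trans (near hC y _) _ => //; rewrite ler_wpM2r //.
  by rewrite (le_trans (ler_norm C)) // lerDl.
rewrite mulrC -ler_pdivlMr ?ltr_wpDl // distrC; near: y.
by apply: cvgr_dist_le => //; rewrite divr_gt0 // ltr_wpDl.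
Unshelve. all: by end_near. Qed.

Lemma sublinear_continuous p C : sublinear p -> norm_dominated C p -> continuous p.
Proof.
move=> sp pC x; apply: (@lipschitz_at_continuous _ _ C); near=> y.
have := pC (y - x); have := pC (x - y); rewrite distrC.
have := sp.1 (x - y) y; have := sp.1 (y - x) x; rewrite !subrK.
by rewrite ler_norml; lra.
Unshelve. all: by end_near. Qed.

Lemma dominated_is_dual f C : scalar f -> norm_dominated C f -> is_dual f.
Proof.
by move=> lf fC; split=> //; exact: sublinear_continuous (scalar_sublinear lf) fC.
Qed.

Lemma is_dualN f : is_dual f -> is_dual (fun x => - f x).
Proof.
move=> [lf cf]; split=> [a u v|x]; first by rewrite (lf a u v) opprD mulrN.
exact: (cvgN (cf x)).
Qed.

Lemma is_dual_dominated f : is_dual f -> exists2 C, 0 < C & norm_dominated C f.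
Proof.
move=> [lf /(_ 0)/cvgr_dist_le/(_ _ ltr01)/nbhs_norm0P[r /= r0 fr]].
have f0 : f 0 = 0 := linear_form0 lf.
exists (2 / r) => [|x]; first by rewrite divr_gt0.
have [->|x0] := eqVneq x 0; first by rewrite f0 normr0 mulr0.
have c0 : 0 < 2 / r * `|x| by rewrite mulr_gt0 ?divr_gt0 ?normr_gt0.
have /fr : `|(2 / r * `|x|)^-1 *: x| < r.
  rewrite normrZ gtr0_norm ?invr_gt0 // mulrC ltr_pdivrMr //.
  by rewrite mulrA [r * _]mulrC divfK ?gt_eqF // ltr_pMl ?normr_gt0 ?ltr1n.
rewrite f0 sub0r normrN (linear_formZ lf) => /(le_trans (ler_norm _)).
by rewrite mulrC ler_pdivrMr // mul1r.
Qed.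

End NormDominated.

(** * Smooth approximation of sublinear functionals *)

(* Subtracting a small multiple of [\sum_i 2^-(i+1) (Q i)^2] from an affine
   functional makes its supremum over [D] strong in every [Q i], because the
   parallelogram identity controls [Q i f - Q i g] for almost maximizers. *)
Section Penalty.
Variables (R : realType) (T : Type) (D : set T) (mid : T -> T -> T).
Variables (Q : nat -> T -> R).
Hypothesis midD : forall f g, D f -> D g -> D (mid f g).
Hypothesis Q01 : forall i f, D f -> 0 <= Q i f <= 1.
Hypothesis Qmid : forall i f g, D f -> D g ->
  Q i (mid f g) <= (Q i f + Q i g) / 2.

Definition penalty_sum n f : R := \sum_(i < n) 2^-1 ^+ i.+1 * Q i f ^+ 2.
Definition penalty f : R := sup [set penalty_sum n f | n in [set: nat]].

Let weight_gt0 i : 0 < 2^-1 ^+ i.+1 :> R.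
Proof. by rewrite exprn_gt0 // invr_gt0. Qed.

Lemma penalty_sum_le1 n f : D f -> penalty_sum n f <= 1.
Proof.
move=> Df; suff : penalty_sum n f <= 1 - 2^-1 ^+ n.
  by move/le_trans; apply; rewrite gerBl exprn_ge0 // invr_ge0.
elim: n => [|n IH]; first by rewrite /penalty_sum big_ord0 expr0 subrr.
rewrite /penalty_sum big_ord_recr /= (le_trans (lerD IH (ler_piMr _ _))) ?(ltW (weight_gt0 _)) //.
  by have /andP[Q0 Q1] := Q01 n Df; exact: exprn_ile1.
by rewrite exprS; lra.
Qed.

Lemma penalty_sum_le_penalty n f : D f -> penalty_sum n f <= penalty f.
Proof.
move=> Df; apply: (@le_sup_image _ _ _ (fun n => penalty_sum n f) 1) => // k _.
exact: penalty_sum_le1.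
Qed.

Lemma penalty_le f b : (forall n, penalty_sum n f <= b) -> penalty f <= b.
Proof. by move=> h; apply: sup_image_le => //; exists 0%N. Qed.

Lemma penalty_le1 f : D f -> penalty f <= 1.
Proof. by move=> Df; apply: penalty_le => n; exact: penalty_sum_le1. Qed.

Lemma penalty_ge0 f : D f -> 0 <= penalty f.
Proof.
by move=> Df; have := penalty_sum_le_penalty 0 Df; rewrite /penalty_sum big_ord0.
Qed.

Lemma penalty_sum_homo f : {homo penalty_sum^~ f : m n / (m <= n)%N >-> m <= n}.
Proof.
apply: homo_leq => [//|m n p|n]; first exact: le_trans.
by rewrite /penalty_sum big_ord_recr /= lerDl mulr_ge0 ?sqr_ge0 // ltW.
Qed.

Lemma sqr_mid_le i f g : D f -> D g ->
  Q i (mid f g) ^+ 2 <= (Q i f ^+ 2 + Q i g ^+ 2) / 2 - (Q i f - Q i g) ^+ 2 / 4.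
Proof.
move=> Df Dg; have /andP[Q0 _] := Q01 i (midD Df Dg).
have := Qmid i Df Dg; rewrite -ler_sqr ?nnegrE // => [/le_trans|].
  by apply; rewrite le_eqVlt; apply/orP; left; apply/eqP; field.
exact: le_trans Q0 (Qmid i Df Dg).
Qed.

Lemma penalty_mid_le i f g : D f -> D g -> penalty (mid f g) <=
  (penalty f + penalty g) / 2 - 2^-1 ^+ i.+1 * (Q i f - Q i g) ^+ 2 / 4.
Proof.
move=> Df Dg; apply: penalty_le => n.
apply: le_trans (penalty_sum_homo (mid f g) (leq_maxr i.+1 n)) _.
set k := maxn i.+1 n; have ik : (i < k)%N by rewrite leq_max leqnn.
have f_le := penalty_sum_le_penalty k Df; have g_le := penalty_sum_le_penalty k Dg.
suff : penalty_sum k (mid f g) <= (penalty_sum k f + penalty_sum k g) / 2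
   - 2^-1 ^+ i.+1 * (Q i f - Q i g) ^+ 2 / 4 by lra.
rewrite /penalty_sum (bigD1 (Ordinal ik)) //= [X in (X + _) / 2](bigD1 (Ordinal ik)) //=.
rewrite [X in (_ + X) / 2](bigD1 (Ordinal ik)) //=.
set A := \sum_(_ < _ | _) _; set B := \sum_(_ < _ | _) _; set E := \sum_(_ < _ | _) _.
have ABE : A <= (B + E) / 2.
  rewrite -big_split /= mulr_suml; apply: ler_sum => j _.
  rewrite -mulrDr -mulrA ler_pM2l ?weight_gt0 //.
  by have := sqr_mid_le j Df Dg; have := sqr_ge0 (Q j f - Q j g); lra.
by have := sqr_mid_le i Df Dg; rewrite -(ler_pM2l (weight_gt0 i)); lra.
Qed.

Variables (ev : T -> R) (eta s : R).
Hypothesis ev_mid : forall f g, ev (mid f g) = (ev f + ev g) / 2.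
Hypothesis eta_gt0 : 0 < eta.
Hypothesis obj_le : forall f, D f -> ev f - eta * penalty f <= s.

Lemma almost_maximizers_close i eps : 0 < eps -> exists2 tau, 0 < tau &
  forall f g, D f -> D g -> s - tau <= ev f - eta * penalty f ->
    s - tau <= ev g - eta * penalty g -> `|Q i f - Q i g| <= eps.
Proof.
move=> e0; pose c := eta * 2^-1 ^+ i.+1 / 4.
have c0 : 0 < c by rewrite divr_gt0 // mulr_gt0.
exists (c * eps ^+ 2) => [|f g Df Dg f_almost g_almost]; first by rewrite mulr_gt0 ?exprn_gt0.
have := penalty_mid_le i Df Dg; rewrite -(ler_pM2l eta_gt0) => pen_mid.
have := obj_le (midD Df Dg); rewrite ev_mid => obj_mid.
rewrite -ler_sqr ?nnegrE ?(ltW e0) // real_normK ?num_real // -(ler_pM2l c0).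
by rewrite /c in f_almost g_almost *; lra.
Qed.

End Penalty.

Section DualNorm.
Variables (R : realType) (V : normedModType R) (M : set V).
Hypothesis sM : Defs.subspace M.
Implicit Types (f g : V -> R).

Lemma subspaceD u v : M u -> M v -> M (u + v).
Proof. by move=> Mu Mv; have := sM.2 1 _ _ Mu Mv; rewrite scale1r. Qed.

Lemma subspaceZ a u : M u -> M (a *: u).
Proof. by move=> Mu; have := sM.2 a _ _ Mu sM.1; rewrite addr0. Qed.

Lemma subspaceB u v : M u -> M v -> M (u - v).
Proof. by move=> Mu Mv; rewrite -scaleN1r addrC; exact: sM.2. Qed.

Definition dual_norm f : R := sup [set f m | m in [set m | M m /\ `|m| <= 1]].

Lemma dual_norm_le f c : (forall m, M m -> `|m| <= 1 -> f m <= c) ->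
  dual_norm f <= c.
Proof.
move=> fc; apply: sup_image_le => [|m [Mm m1]]; last exact: fc.
by exists 0 => /=; split; [exact: sM.1|rewrite normr0].
Qed.

Lemma le_dual_norm_unit f C m : scalar f -> norm_dominated C f -> M m -> `|m| <= 1 ->
  f m <= dual_norm f.
Proof.
move=> lf fC Mm m1; apply: (@le_sup_image _ _ _ f `|C|) => //= u [_ u1].
by rewrite (le_trans (fC u)) // (le_trans (ler_wpM2r _ (ler_norm C))) // ler_piMr.
Qed.

Lemma le_dual_norm f C m : scalar f -> norm_dominated C f -> M m ->
  f m <= dual_norm f * `|m|.
Proof.
move=> lf fC Mm; have [->|m0] := eqVneq m 0.
  by rewrite (linear_form0 lf) normr0 mulr0.
have m_gt0 : 0 < `|m| by rewrite normr_gt0.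
rewrite -ler_pdivrMr // mulrC -(linear_formZ lf).
apply: le_dual_norm_unit lf fC (subspaceZ _ Mm) _.
by rewrite normrZ normfV normr_id mulVf ?gt_eqF.
Qed.

Lemma dual_norm_ge0 f C : scalar f -> norm_dominated C f -> 0 <= dual_norm f.
Proof.
move=> lf fC; rewrite -(linear_form0 lf).
by apply: le_dual_norm_unit lf fC sM.1 _; rewrite normr0.
Qed.

End DualNorm.

Lemma ultra_bounded_cvg (R : realType) (U : set_system nat) (u : nat -> R) (b : R) :
  UltraFilter U -> (forall n, `|u n| <= b) -> cvg (u @ U).
Proof.
move=> UU ub; have UP : ProperFilter U := @ultra_proper _ _ UU.
have u_in : (u @ U) `[- b, b]%classic.
  by apply: nearW => n /=; rewrite in_itv /= -ler_norml.
have [l [_ ul]] := @segment_compact R (- b) b _ _ u_in.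
apply/cvg_ex; exists l => A lA; have [//|UnA] := in_ultra_setVsetC (u @^-1` A) UU.
by have [y [nAy Ay]] := ul (~` A) A UnA lA.
Qed.

Definition linear_minorant (R : realType) (V : lmodType R) (p : V -> R) : set (V -> R) :=
  [set f | scalar f /\ forall x, f x <= p x].

Definition dual_dense_on (R : realType) (V : normedModType R) (M : set V)
    (phi : nat -> V -> R) : Prop :=
  forall f, is_dual f -> forall eps, 0 < eps ->
    exists n, forall m, M m -> `|f m - phi n m| <= eps * `|m|.

Definition frechet_supergradient_on (R : realType) (V : normedModType R) (M : set V)
    (phi : V -> R) (x : V) (f : V -> R) : Prop :=
  forall eps, 0 < eps -> \forall h \near (0 : V), M h ->
    phi (x + h) - phi x <= f h + eps * `|h|.

(* The supremum of the affine functionals [f x - eta * penalty f] over the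
   linear minorants [f] of [q]. With the distances to a dense sequence of the
   dual of [M] as the [Q i], strong maximality becomes norm convergence of
   almost maximizers, which is Frechet superdifferentiability. *)
Section Smoothing.
Variables (R : realType) (V : normedModType R) (M : set V).
Hypothesis sM : Defs.subspace M.
Variables (phi : nat -> V -> R) (B : nat -> R).
Hypotheses (lphi : forall n, scalar (phi n)) (B_gt0 : forall n, 0 < B n).
Hypothesis phiB : forall n, norm_dominated (B n) (phi n).
Hypothesis phi_dense : dual_dense_on M phi.
Variables (q : V -> R) (C eta : R).
Hypotheses (sq : sublinear q) (qC : norm_dominated C q).
Hypotheses (C_gt0 : 0 < C) (eta_gt0 : 0 < eta).

Local Notation D := (linear_minorant q).
Let mid (f g : V -> R) : V -> R := fun x => (f x + g x) / 2.

Definition dual_gap n (f : V -> R) : R := dual_norm M (f \- phi n) / (C + B n).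
Local Notation Q := dual_gap.

Definition penalized x (f : V -> R) : R := f x - eta * penalty Q f.
Local Notation obj := penalized.

Definition smoothing (x : V) : R := sup [set obj x f | f in D].

Let CB_gt0 n : 0 < C + B n. Proof. exact: addr_gt0. Qed.

Let D_dominated f : D f -> norm_dominated C f.
Proof. by move=> [_ fq] x; exact: le_trans (fq x) (qC x). Qed.

Let diff_scalar n f : D f -> scalar (f \- phi n).
Proof. by move=> [lf _] a u v /=; rewrite lf lphi; ring. Qed.

Let diff_dominated n f : D f -> norm_dominated (C + B n) (f \- phi n).
Proof.
move=> Df x; have := D_dominated Df x; have := phiB n (- x).
by rewrite (linear_formN (lphi n)) normrN /=; lra.
Qed.

Let midD f g : D f -> D g -> D (mid f g).
Proof.
move=> [lf fq] [lg gq]; split=> [a u v|x]; first by rewrite /mid lf lg; field.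
by have := fq x; have := gq x; rewrite /mid; lra.
Qed.

Let Q01 n f : D f -> 0 <= Q n f <= 1.
Proof.
move=> Df; have lfn := diff_scalar n Df; have fnC := diff_dominated n Df.
rewrite divr_ge0 ?(ltW (CB_gt0 n)) ?(dual_norm_ge0 sM lfn fnC) //=.
rewrite ler_pdivrMr // mul1r; apply: dual_norm_le => // m _ m1.
by apply: le_trans (fnC m) _; rewrite ler_piMr // ltW.
Qed.

Let diff_le_gap n f m : D f -> M m ->
  f m - phi n m <= Q n f * (C + B n) * `|m|.
Proof.
move=> Df Mm; rewrite /dual_gap divfK ?gt_eqF //.
exact: (le_dual_norm sM (diff_scalar n Df) (diff_dominated n Df) Mm).
Qed.

Let diff_le_gap1 n f m : D f -> M m -> `|m| <= 1 ->
  f m - phi n m <= Q n f * (C + B n).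
Proof.
move=> Df Mm m1; apply: le_trans (diff_le_gap n Df Mm) _.
by rewrite ler_piMr // mulr_ge0 ?(ltW (CB_gt0 n)) //; have /andP[] := Q01 n Df.
Qed.

Let Qmid n f g : D f -> D g -> Q n (mid f g) <= (Q n f + Q n g) / 2.
Proof.
move=> Df Dg; rewrite ler_pdivrMr //; apply: dual_norm_le => // m Mm m1.
have := diff_le_gap1 n Df Mm m1; have := diff_le_gap1 n Dg Mm m1.
by rewrite /mid /=; lra.
Qed.

Let D_support x : exists2 f, D f & f x = q x.
Proof. by have [f [lf fq fx]] := Hahn_Banach_support x sq; exists f. Qed.

Let D_neq0 : D !=set0. Proof. by have [f Df _] := D_support 0; exists f. Qed.

Let obj_le_q x f : D f -> obj x f <= q x.
Proof.
move=> Df; apply: le_trans (Df.2 x); rewrite gerBl.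
by rewrite mulr_ge0 ?(ltW eta_gt0) // (penalty_ge0 Q01).
Qed.

Let obj_le_smoothing x f : D f -> obj x f <= smoothing x.
Proof. by move=> Df; apply: (@le_sup_image _ _ _ (obj x)) => // g; exact: obj_le_q. Qed.

Let smoothing_le x c : (forall f, D f -> obj x f <= c) -> smoothing x <= c.
Proof. by move=> h; exact: sup_image_le. Qed.

Lemma smoothing_approx x : q x - eta <= smoothing x <= q x.
Proof.
rewrite smoothing_le ?andbT => [|f]; last exact: obj_le_q.
have [f Df fx] := D_support x; apply: le_trans (obj_le_smoothing x Df).
by rewrite /penalized fx lerD2l lerN2 ler_piMr ?(ltW eta_gt0) // (penalty_le1 Q01).
Qed.

Lemma smoothing_lipschitz x y : smoothing y <= smoothing x + C * `|y - x|.
Proof.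
apply: smoothing_le => f Df; have := obj_le_smoothing x Df.
by have := D_dominated Df (y - x); rewrite (linear_formB Df.1) /penalized; lra.
Qed.

Section UltraLimit.
Variables (U : set_system nat) (F : nat -> V -> R).
Hypotheses (UU : UltraFilter U) (FD : forall k, D (F k)).

Let UP : ProperFilter U := @ultra_proper _ _ UU.
Local Notation f := (fun y : V => lim (F^~ y @ U)).

Lemma ultralimit_cvg y : F^~ y @ U --> f y.
Proof.
apply: (ultra_bounded_cvg (b := C * `|y|)) => k.
exact: norm_dominated_abs (FD k).1 (D_dominated (FD k)) y.
Qed.

Lemma ultralimit_minorant : D f.
Proof.
split=> [a u v|x]; last first.
  by apply: cvgr_to_le (@ultralimit_cvg x) _; apply: nearW => k; exact: (FD k).2.
have lim_comb : (fun k => F k (a *: u + v)) @ U --> a * f u + f v.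
  under eq_fun do rewrite (FD _).1.
  exact: (cvgD (cvgMl_tmp (@ultralimit_cvg u)) (@ultralimit_cvg v)).
exact: cvg_unique (@ultralimit_cvg _) lim_comb.
Qed.

Lemma penalty_sum_ultralimit_le n (u : nat -> R) b : u @ U --> b ->
  (forall k, penalty_sum Q n (F k) <= u k) -> penalty_sum Q n f <= b.
Proof.
move=> ub Fu.
have Q_cvg i : cvg (Q i (F k) @[k --> U]).
  apply: (ultra_bounded_cvg (b := 1)) => // k.
  by have /andP[Q0 Q1] := Q01 i (FD k); rewrite ger0_norm.
have Q_lim i : Q i f <= lim (Q i (F k) @[k --> U]).
  rewrite ler_pdivrMr //; apply: dual_norm_le => // m Mm m1.
  apply: ler_cvg_to (cvgB (@ultralimit_cvg m) (cvg_cst _)) (cvgMr_tmp (Q_cvg i)) _.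
  by apply: nearW => k; exact: diff_le_gap1.
have Q0 i : 0 <= Q i f by have /andP[] := Q01 i ultralimit_minorant.
pose l i := lim (Q i (F k) @[k --> U]).
have sum_cvg : penalty_sum Q n (F k) @[k --> U] --> \sum_(i < n) 2^-1 ^+ i.+1 * l i ^+ 2.
  apply: cvg_big => [|i _]; first exact: add_continuous.
  by apply: cvgMl_tmp; apply: cvgM; exact: Q_cvg.
apply: (@le_trans _ _ (\sum_(i < n) 2^-1 ^+ i.+1 * l i ^+ 2)).
  apply: ler_sum => i _; rewrite ler_pM2l ?exprn_gt0 ?invr_gt0 //.
  by rewrite ler_sqr ?nnegrE // (le_trans _ (Q_lim i)).
by apply: ler_cvg_to sum_cvg ub _; exact: nearW.
Qed.

End UltraLimit.

Lemma smoothing_attained x : exists2 f, D f & smoothing x <= obj x f.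
Proof.
have obj_sup : has_sup [set obj x f | f in D].
  split; first by have [f Df] := D_neq0; exists (obj x f), f.
  by exists (q x) => _ [f Df <-]; exact: obj_le_q.
have /choice[F FD] : forall k, exists f, D f /\ smoothing x - harmonic k <= obj x f.
  move=> k; have [_ [f Df <-] /ltW h] := sup_adherent (@harmonic_gt0 R k) obj_sup.
  by exists f.
have [U [UU ooU]] := ultraFilterLemma eventually_filter.
have DF k : D (F k) by have [] := FD k.
have F_cvg := ultralimit_cvg (y := x) UU DF.
exists (fun y => lim (F^~ y @ U)); first exact: ultralimit_minorant.
rewrite lerBrDr -lerBrDl mulrC -ler_pdivlMr //; apply: penalty_le => n.
apply: (@penalty_sum_ultralimit_le _ _ UU DF n
  (fun k => (F k x - smoothing x + harmonic k) / eta)).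
  apply: cvgMr_tmp; rewrite -[X in _ --> X]addr0; apply: cvgD.
    by apply: cvgB => //; exact: cvg_cst.
  exact: cvg_trans (cvg_app _ ooU) cvg_harmonic.
move=> k; have [_] := FD k; rewrite /penalized ler_pdivlMr //.
have := penalty_sum_le_penalty Q01 n (DF k); rewrite -(ler_pM2l eta_gt0).
lra.
Qed.

Lemma smoothing_superdifferentiable x : exists f,
  [/\ scalar f, forall h, f h <= q h & frechet_supergradient_on M smoothing x f].
Proof.
have [f0 Df0 f0_max] := smoothing_attained x.
exists f0; split; [exact: Df0.1|exact: Df0.2|move=> eps e0].
have e3_gt0 : 0 < eps / 3 by rewrite divr_gt0.
have [n f0_phi] := phi_dense (dominated_is_dual Df0.1 (D_dominated Df0)) e3_gt0.
have gap0 : Q n f0 * (C + B n) <= eps / 3.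
  rewrite /dual_gap divfK ?gt_eqF //; apply: dual_norm_le => // m Mm m1.
  apply: le_trans (ler_norm _) (le_trans (f0_phi _ Mm) _).
  by rewrite ler_piMr // ltW.
have mid_eval f g : mid f g x = (f x + g x) / 2 by [].
have [tau tau0 close] := almost_maximizers_close midD Q01 Qmid mid_eval eta_gt0
  (obj_le_smoothing x) n (divr_gt0 e3_gt0 (CB_gt0 n)).
have C2_gt0 : 0 < 2 * C by rewrite mulr_gt0.
apply: filterS (nbhs0_le (divr_gt0 tau0 C2_gt0)) => h; rewrite ler_pdivlMr // => h_small Mh.
rewrite lerBlDr; apply: smoothing_le => f Df; rewrite /penalized (linear_formD Df.1).
have [ht|ht] := leP (smoothing x - tau) (obj x f); last first.
  have := norm_dominated_abs Df.1 (D_dominated Df) h.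
  have := norm_dominated_abs Df0.1 (D_dominated Df0) h.
  have := mulr_ge0 (ltW e0) (normr_ge0 h); rewrite !ler_norml.
  by move: ht; rewrite /penalized; lra.
have f0_near : smoothing x - tau <= obj x f0 by lra.
have gapf : Q n f * (C + B n) <= 2 * (eps / 3).
  have := close _ _ Df Df0 ht f0_near; rewrite ler_pdivlMr // => gap_close.
  have := ler_norm (Q n f - Q n f0); have := CB_gt0 n; nra.
have f_phi : f h - phi n h <= 2 * (eps / 3) * `|h|.
  by apply: le_trans (diff_le_gap n Df Mh) _; rewrite ler_wpM2r.
have := f0_phi _ Mh; rewrite ler_norml => /andP[phi_f0 _].
by have := obj_le_smoothing x Df; rewrite /penalized; lra.
Qed.

End Smoothing.

Lemma dual_on_extend (R : realType) (V : normedModType R) (M : set V) (f : V -> R) :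
  Defs.subspace M -> dual_on M f ->
  exists2 F, is_dual F & forall m, M m -> F m = f m.
Proof.
move=> sM [lf [C fC]].
have f0 : f 0 = 0 by have := lf (-1) _ _ sM.1 sM.1; rewrite scaler0 addr0; lra.
pose G c r := M c /\ r = - f c.
have cG : convex_cone_rel G.
  split=> [|u _ v _ [Mu ->] [Mv ->]|t u _ _ [Mu ->]].
  - by split; [exact: sM.1|rewrite f0 oppr0].
  - split; first exact: subspaceD.
    by have := lf 1 _ _ Mu Mv; rewrite scale1r; lra.
  - split; first exact: subspaceZ.
    by have := lf t _ _ Mu sM.1; rewrite addr0 f0; lra.
have pG c r : G c r -> 0 <= `|C| * `|c| + r.
  move=> [Mc ->]; rewrite subr_ge0 (le_trans (ler_norm _)) // (le_trans (fC _ Mc)) //.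
  by rewrite ler_wpM2r // ler_norm.
have spC := sublinearZ (normr_ge0 C) (@norm_sublinear _ V).
have [F [lF FC FG]] := Hahn_Banach_cone spC cG pG.
have f_le_F m : M m -> f m <= F m by move=> Mm; rewrite -[f m]opprK; exact: FG.
exists F => [|m Mm]; first exact: dominated_is_dual lF FC.
apply/eqP; rewrite eq_le f_le_F // andbT -lerN2 -(linear_formN lF).
have := lf (-1) _ _ Mm sM.1; rewrite addr0 f0 scaleN1r mulN1r addr0 => <-.
by apply: f_le_F; rewrite -scaleN1r; exact: subspaceZ.
Qed.

Lemma is_dual_dual_on (R : realType) (V : normedModType R) (M : set V) (f : V -> R) :
  is_dual f -> dual_on M f.
Proof.
move=> df; have [C _ fC] := is_dual_dominated df.
by split=> [a u v _ _|]; [exact: df.1|exists C => m _; exact: norm_dominated_abs df.1 fC m].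
Qed.

Lemma separable_dualP (R : realType) (V : normedModType R) (M : set V) :
  Defs.subspace M -> separable_dual M <->
  exists phi : nat -> V -> R, (forall n, is_dual (phi n)) /\ dual_dense_on M phi.
Proof.
move=> sM; split=> [[phi [dphi phi_dense]]|[phi [dphi phi_dense]]].
  have /choice[psi psiP] n : exists psi, is_dual psi /\ forall m, M m -> psi m = phi n m.
    by have [F dF Fphi] := dual_on_extend sM (dphi n); exists F.
  exists psi; split=> [n|f df eps e0]; first by case: (psiP n).
  have [n phi_n] := phi_dense f (is_dual_dual_on M df) _ e0.
  by exists n => m Mm; rewrite (psiP n).2 // phi_n.
exists phi; split=> [n|f df eps e0]; first exact: is_dual_dual_on.
have [F dF Ff] := dual_on_extend sM df; have [n phi_n] := phi_dense F dF _ e0.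
by exists n => m Mm; rewrite -Ff // phi_n.
Qed.

Lemma sublinear_smooth_approx (R : realType) (V : normedModType R) (M : set V)
    (q : V -> R) (C eta : R) :
    Defs.subspace M -> separable_dual M -> sublinear q -> norm_dominated C q ->
    0 < C -> 0 < eta ->
  exists kappa : V -> R,
  [/\ forall x, q x - eta <= kappa x <= q x,
      forall x y, kappa y <= kappa x + C * `|y - x| &
      forall x, exists f, [/\ scalar f, forall h, f h <= q h &
        frechet_supergradient_on M kappa x f]].
Proof.
move=> sM /(separable_dualP sM)[phi [dphi phi_dense]] sq qC C0 eta0.
have /choice[B phiB] n : exists b, 0 < b /\ norm_dominated b (phi n).
  by have [b b0 phib] := is_dual_dominated (dphi n); exists b.
have lphi n : scalar (phi n) := (dphi n).1.
have B_gt0 n : 0 < B n by case: (phiB n).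
have phi_dom n : norm_dominated (B n) (phi n) by case: (phiB n).
exists (smoothing M phi B q C eta); split.
- exact: smoothing_approx.
- exact: smoothing_lipschitz.
- exact: smoothing_superdifferentiable.
Qed.

(** * A smooth variational principle *)

Section Geometric.
Variable R : realType.

Lemma half_pow_gt0 n : 0 < 2^-1 ^+ n :> R.
Proof. by rewrite exprn_gt0 // invr_gt0. Qed.

Lemma half_pow_le1 n : 2^-1 ^+ n <= 1 :> R.
Proof. by rewrite exprn_ile1 // ?invr_ge0 // invf_le1 // ler1n. Qed.

Lemma half_powS n : 2^-1 ^+ n.+1 = 2^-1 ^+ n / 2 :> R.
Proof. by rewrite exprS mulrC. Qed.

Lemma cvg_half_pow (c : R) : c * 2^-1 ^+ n @[n --> \oo] --> 0.
Proof. by apply: cvg_geometric; rewrite gtr0_norm ?invr_gt0 // invf_lt1 // ltr1n. Qed.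

Lemma geometric_dist (V : normedModType R) (u : nat -> V) (c : R) : 0 <= c ->
    (forall n, `|u n.+1 - u n| <= c * 2^-1 ^+ n.+1) ->
  forall n m, (n <= m)%N -> `|u m - u n| <= c * 2^-1 ^+ n.
Proof.
move=> c0 u_step n m nm.
suff : `|u m - u n| <= c * (2^-1 ^+ n - 2^-1 ^+ m).
  by have := mulr_ge0 c0 (ltW (half_pow_gt0 m)); lra.
elim: m nm => [|m IH]; first by rewrite leqn0 => /eqP ->; rewrite !subrr normr0 mulr0.
rewrite leq_eqVlt => /orP[/eqP ->|]; first by rewrite !subrr normr0 mulr0.
rewrite ltnS => /IH; have := u_step m; rewrite !half_powS.
by have := ler_distD (u m) (u m.+1) (u n); lra.
Qed.

Lemma geometric_cvg (V : completeNormedModType R) (u : nat -> V) (c : R) : 0 <= c ->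
    (forall n, `|u n.+1 - u n| <= c * 2^-1 ^+ n.+1) ->
  exists2 l, u @ \oo --> l & forall n, `|l - u n| <= c * 2^-1 ^+ n.
Proof.
move=> c0 /(geometric_dist c0) u_dist.
have : cvgn u.
  apply: cauchy_cvg; apply: cauchy_exP => e e0.
  have /cvgr0_norm_lt/(_ _ e0)[N _ hN] := cvg_half_pow c.
  exists (u N); exists N => // m /= Nm; rewrite -ball_normE /= distrC.
  apply: le_lt_trans (u_dist _ _ Nm) _; apply: le_lt_trans (hN N (leqnn N)).
  exact: ler_norm.
move=> /cvg_ex[l ul]; exists l => // n.
apply: cvgr_to_le (cvg_norm (cvgB ul (cvg_cst (u n)))) _.
by exists n => // m /= nm; exact: u_dist.
Qed.

End Geometric.

Definition perturbed (R : realType) (V : lmodType R) (phi : V -> R) (mu : R)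
    (k : nat -> V -> R) (x : nat -> V) (J : nat) (y : V) : R :=
  phi y + \sum_(n < J) mu * 2^-1 ^+ n.+1 * k n (y - x n).

Section Perturbed.
Variables (R : realType) (V : lmodType R) (phi : V -> R) (mu : R).
Variables (k : nat -> V -> R) (x : nat -> V).

Lemma perturbed0 y : perturbed phi mu k x 0 y = phi y.
Proof. by rewrite /perturbed big_ord0 addr0. Qed.

Lemma perturbedS J y : perturbed phi mu k x J.+1 y =
  perturbed phi mu k x J y + mu * 2^-1 ^+ J.+1 * k J (y - x J).
Proof. by rewrite /perturbed big_ord_recr addrA. Qed.

End Perturbed.

(* The Borwein-Preiss principle: the points [x n] are chosen inductively as
   almost minimizers of [phi] perturbed by the gauges [k j] centred at [x j] for
   [j < n], and the gauges force [x] to be Cauchy. The conclusion avoids the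
   infinite sum of gauges by bounding its tail. *)
Section BorweinPreiss.
Variables (R : realType) (V : completeNormedModType R) (A : set V).
Variables (phi : V -> R) (k : nat -> V -> R) (L theta mu : R) (xb : V).
Hypotheses (clA : closed A) (Axb : A xb).
Hypotheses (L_ge0 : 0 <= L) (theta_gt0 : 0 < theta) (mu_gt0 : 0 < mu).
Hypothesis phi_lip : forall x y, phi y <= phi x + L * `|y - x|.
Hypothesis k_norm : forall n h, `|h| - theta * 2^-1 ^+ n / 4 <= k n h <= `|h|.
Hypothesis k_lip : forall n x y, k n y <= k n x + `|y - x|.

Local Notation tol n := (theta * mu * 2^-1 ^+ n * 2^-1 ^+ n / 16).
Local Notation pert := (perturbed phi mu k).

Let weight_gt0 n : 0 < mu * 2^-1 ^+ n.+1.
Proof. by rewrite mulr_gt0 // half_pow_gt0. Qed.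

Lemma perturbed_tail x J m y z : (J <= m)%N ->
  pert x m y - pert x m z <=
    pert x J y - pert x J z + mu * (2^-1 ^+ J - 2^-1 ^+ m) * `|y - z|.
Proof.
elim: m => [|m IH]; first by rewrite leqn0 => /eqP ->; rewrite subrr mulr0 mul0r addr0.
rewrite leq_eqVlt => /orP[/eqP ->|]; first by rewrite subrr mulr0 mul0r addr0.
rewrite ltnS => /IH; rewrite !perturbedS.
have := k_lip m (z - x m) (y - x m); rewrite opprB addrA subrK.
by rewrite -(ler_pM2l (weight_gt0 m)) !half_powS; lra.
Qed.

Lemma perturbed_lipschitz x J y z :
  pert x J y <= pert x J z + (L + mu) * `|y - z|.
Proof.
have := perturbed_tail x y z (leq0n J); rewrite !perturbed0 expr0 -lerBlDl.
have := phi_lip z y; have := mulr_ge0 (ltW mu_gt0) (normr_ge0 (y - z)).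
have := mulr_ge0 (ltW (half_pow_gt0 R J)) (mulr_ge0 (ltW mu_gt0) (normr_ge0 (y - z))).
lra.
Qed.

Section AlmostMinimizers.
Variable x : nat -> V.
Hypotheses (Ax : forall n, A (x n)) (x0 : x 0%N = xb).
Hypothesis x_min : forall n y, A y -> pert x n (x n) <= pert x n y + tol n.

Lemma almost_minimizers_step n : `|x n.+1 - x n| <= theta * 2^-1 ^+ n.+1.
Proof.
have := x_min n.+1 (Ax n); have := x_min n (Ax n.+1); rewrite !perturbedS subrr.
have /andP[k_ge _] := k_norm n (x n.+1 - x n).
have /andP[_] := k_norm n 0; rewrite normr0 -(pmulr_rle0 _ (weight_gt0 n)) => k0 min_n min_Sn.
have : mu * 2^-1 ^+ n.+1 * k n (x n.+1 - x n) <=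
       mu * 2^-1 ^+ n.+1 * (theta * 2^-1 ^+ n / 4).
  move: min_n min_Sn k0; rewrite half_powS.
  have : 0 < theta * mu * 2^-1 ^+ n * 2^-1 ^+ n by rewrite !mulr_gt0 ?half_pow_gt0.
  by lra.
by rewrite ler_pM2l // half_powS => k_le; have := half_pow_gt0 R n; lra.
Qed.

Lemma almost_minimizers_limit : exists xi,
  [/\ A xi, `|xi - xb| <= theta &
      forall J y, A y -> pert x J xi <= pert x J y + mu * 2^-1 ^+ J * `|y - xi|].
Proof.
have [xi x_xi x_dist] := geometric_cvg (ltW theta_gt0) almost_minimizers_step.
exists xi; split.
- by apply: closed_cvg clA _ _ x_xi; exact: nearW.
- by have := x_dist 0%N; rewrite expr0 mulr1 x0.
move=> J y Ay; apply/ler_addgt0Pr => e e0.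
pose c := theta * mu + (L + mu) * theta.
have /cvgr0_norm_le/(_ _ e0)[N _ hN] := cvg_half_pow c.
pose m := maxn J N; have := hN m (leq_maxr J N) => /(le_trans (ler_norm _)).
have := perturbed_tail x y xi (leq_maxl J N : (J <= m)%N).
have := perturbed_lipschitz x m xi (x m); have := x_min m Ay.
have : (L + mu) * `|xi - x m| <= (L + mu) * (theta * 2^-1 ^+ m).
  by rewrite ler_wpM2l ?x_dist // addr_ge0 // ltW.
have : theta * mu * 2^-1 ^+ m * 2^-1 ^+ m <= theta * mu * 2^-1 ^+ m.
  by rewrite ler_piMr ?half_pow_le1 // !mulr_ge0 ?(ltW (half_pow_gt0 R m)) // ltW.
have : 0 <= theta * mu * 2^-1 ^+ m by rewrite !mulr_ge0 ?(ltW (half_pow_gt0 R m)) // ltW.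
have : 0 <= 2^-1 ^+ m * (mu * `|y - xi|).
  by rewrite !mulr_ge0 ?(ltW (half_pow_gt0 R m)) // ltW.
by rewrite /c; lra.
Qed.

End AlmostMinimizers.

Lemma almost_minimizer_exists (f : V -> R) b e : (forall y, A y -> b <= f y) -> 0 < e ->
  exists2 x, A x & forall y, A y -> f x <= f y + e.
Proof.
move=> fb e0; have f_inf : has_inf [set f y | y in A].
  by split; [exists (f xb), xb|exists b => _ [y Ay <-]; exact: fb].
have [_ [x Ax <-] fx] := inf_adherent e0 f_inf; exists x => // y Ay.
by apply: le_trans (ltW fx) _; rewrite lerD2r; exact: inf_image_le fb Ay.
Qed.

Hypothesis xb_min : forall y, A y -> phi xb <= phi y + tol 0.

Lemma perturbed_lower_bound x n : exists b, forall y, A y -> b <= pert x n y.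
Proof.
elim: n => [|n [b pert_b]].
  by exists (phi xb - tol 0) => y /xb_min; rewrite perturbed0; lra.
exists (b - mu * 2^-1 ^+ n.+1 * (theta * 2^-1 ^+ n / 4)) => y /pert_b.
rewrite perturbedS; have /andP[+ _] := k_norm n (y - x n).
by rewrite -(ler_pM2l (weight_gt0 n)); have := normr_ge0 (y - x n); have := weight_gt0 n; nra.
Qed.

Lemma almost_minimizers_exist : exists x : nat -> V, [/\ forall n, A (x n),
  x 0%N = xb & forall n y, A y -> pert x n (x n) <= pert x n y + tol n].
Proof.
pose next (s t : nat * V * (V -> R)) :=
  [/\ t.1.1 = s.1.1.+1, t.2 = (fun y => s.2 y + mu * 2^-1 ^+ s.1.1.+1 * k s.1.1 (y - s.1.2)),
      A t.1.2 & (exists b, forall y, A y -> b <= t.2 y) ->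
        forall y, A y -> t.2 t.1.2 <= t.2 y + tol t.1.1].
have next_exists s : {t | next s t}.
  apply/cid; case: s => [[n x] f] /=.
  pose f' y := f y + mu * 2^-1 ^+ n.+1 * k n (y - x).
  have [[b fb]|unbounded] := pselect (exists b, forall y, A y -> b <= f' y).
    have [|y Ay y_min] := @almost_minimizer_exists f' b (tol n.+1) fb.
      by rewrite divr_gt0 // !mulr_gt0 ?half_pow_gt0.
    by exists (n.+1, y, f').
  by exists (n.+1, xb, f'); split.
have [s [s0 s_next]] := dependent_choice next_exists (0%N, xb, phi).
pose x n := (s n).1.2; exists x.
have s_n n : (s n).1.1 = n.
  by elim: n => [|n IH]; [rewrite s0|case: (s_next n) => ->; rewrite IH].
have s_f n : (s n).2 = pert x n.
  apply/funext => y; elim: n => [|n IH]; first by rewrite s0 perturbed0.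
  by case: (s_next n) => _ -> _ _; rewrite s_n perturbedS IH.
have Ax n : A (x n) by case: n => [|n]; [rewrite /x s0|case: (s_next n)].
split=> // [|n y Ay]; first by rewrite /x s0.
case: n => [|n]; first by rewrite !perturbed0 /x s0 xb_min.
by case: (s_next n) => _ _ _; rewrite s_f s_n => -> //; exact: perturbed_lower_bound.
Qed.

Theorem Borwein_Preiss : exists (x : nat -> V) (xi : V),
  [/\ forall n, A (x n), A xi, `|xi - xb| <= theta &
      forall J y, A y -> pert x J xi <= pert x J y + mu * 2^-1 ^+ J * `|y - xi|].
Proof.
have [x [Ax x0 x_min]] := almost_minimizers_exist.
by have [xi [Axi xib xi_min]] := almost_minimizers_limit Ax x0 x_min; exists x, xi.
Qed.

End BorweinPreiss.

(** * The fuzzy multiplier rule in a separable subspace *)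

Definition frechet_normal_ineq (R : realType) (V : normedModType R) (A : set V)
    (x : V) (f : V -> R) : Prop :=
  forall eps, 0 < eps -> \forall h \near (0 : V), A (x + h) -> f h <= eps * `|h|.

Section Supergradient.
Variables (R : realType) (V : normedModType R) (M : set V).
Implicit Types (phi psi f g : V -> R).

Lemma frechet_supergradientD phi psi x f g :
  frechet_supergradient_on M phi x f -> frechet_supergradient_on M psi x g ->
  frechet_supergradient_on M (phi \+ psi) x (f \+ g).
Proof.
move=> phi_f psi_g eps e0; have e2_gt0 : 0 < eps / 2 by rewrite divr_gt0.
near=> h => Mh /=.
have : phi (x + h) - phi x <= f h + eps / 2 * `|h| by apply: (near (phi_f _ e2_gt0) h).
have : psi (x + h) - psi x <= g h + eps / 2 * `|h| by apply: (near (psi_g _ e2_gt0) h).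
lra.
Unshelve. all: by end_near. Qed.

Lemma frechet_supergradientZ phi x f (c : R) : 0 < c ->
  frechet_supergradient_on M phi x f ->
  frechet_supergradient_on M (fun y => c * phi y) x (fun h => c * f h).
Proof.
move=> c0 phi_f eps e0; apply: filterS (phi_f _ (divr_gt0 e0 c0)) => h phi_h Mh.
have := phi_h Mh; rewrite -(ler_pM2l c0) mulrBr mulrDr => /le_trans; apply.
by rewrite lerD2l mulrA [c * _]mulrC divfK // gt_eqF.
Qed.

Lemma frechet_supergradient_shift phi x y f :
  frechet_supergradient_on M phi (x - y) f ->
  frechet_supergradient_on M (fun z => phi (z - y)) x f.
Proof.
move=> phi_f eps e0; apply: filterS (phi_f _ e0) => h phi_h Mh.
by rewrite addrAC; exact: phi_h.
Qed.

Lemma perturbed_supergradient phi mu k (x : nat -> V) xi g0 (g : nat -> V -> R) J :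
  0 < mu -> frechet_supergradient_on M phi xi g0 ->
  (forall n, frechet_supergradient_on M (k n) (xi - x n) (g n)) ->
  frechet_supergradient_on M (perturbed phi mu k x J) xi
    (fun h => g0 h + \sum_(n < J) mu * 2^-1 ^+ n.+1 * g n h).
Proof.
move=> mu0 phi_g0 k_g; elim: J => [|J IH] eps e0.
  apply: filterS (phi_g0 _ e0) => h phi_h Mh.
  by rewrite !perturbed0 big_ord0 addr0; exact: phi_h.
have w0 : 0 < mu * 2^-1 ^+ J.+1 by rewrite mulr_gt0 // half_pow_gt0.
have k_super := frechet_supergradientZ w0 (frechet_supergradient_shift (k_g J)).
apply: filterS (frechet_supergradientD IH k_super e0) => h pert_h Mh.
by rewrite !perturbedS big_ord_recr /= addrA; exact: pert_h.
Qed.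

Lemma geometric_series_scalar mu g0 (g : nat -> V -> R) : 0 <= mu -> scalar g0 ->
    (forall n, scalar (g n)) -> (forall n h, `|g n h| <= `|h|) ->
  exists2 G, scalar G & forall J h,
    `|G h - (g0 h + \sum_(n < J) mu * 2^-1 ^+ n.+1 * g n h)| <= mu * `|h| * 2^-1 ^+ J.
Proof.
move=> mu0 lg0 lg g_le.
pose S J h : R^o := g0 h + \sum_(n < J) mu * 2^-1 ^+ n.+1 * g n h.
have S_step h J : `|S J.+1 h - S J h| <= mu * `|h| * 2^-1 ^+ J.+1.
  have -> : S J.+1 h = S J h + mu * 2^-1 ^+ J.+1 * g J h by rewrite /S big_ord_recr addrA.
  rewrite addrC addKr !normrM (ger0_norm mu0) gtr0_norm ?half_pow_gt0 //.
  by rewrite [leRHS]mulrAC ler_wpM2l // mulr_ge0 // ltW ?half_pow_gt0.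
have /choice[G GS] h : exists l : R^o, S^~ h @ \oo --> l /\
    forall J, `|l - S J h| <= mu * `|h| * 2^-1 ^+ J.
  by have [|l] := @geometric_cvg R R^o (S^~ h) _ _ (S_step h); [rewrite mulr_ge0|exists l].
exists G => [a u v|J h]; last by have [_] := GS h; exact.
have S_scalar J : S J (a *: u + v) = a * S J u + S J v.
  rewrite /S lg0 mulrDr mulr_sumr addrACA -big_split /=; congr (_ + _).
  by apply: eq_bigr => n _; rewrite lg; ring.
have [Gu _] := GS u; have [Gv _] := GS v; have [Guv _] := GS (a *: u + v).
have lim_comb : S^~ (a *: u + v) @ \oo --> a * G u + G v.
  by under eq_fun do rewrite S_scalar; exact: (cvgD (cvgMl_tmp Gu) Gv).
exact: (cvg_unique _ Guv lim_comb).
Qed.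

Lemma frechet_normal_ineq_local (A B : set V) x f :
  (\forall h \near (0 : V), B (x + h) -> A (x + h)) ->
  frechet_normal_ineq A x f -> frechet_normal_ineq B x f.
Proof.
move=> BA Af eps e0; near=> h => Bh.
by apply: (near (Af _ e0) h) => //; apply: (near BA h).
Unshelve. all: by end_near. Qed.

Lemma perturbed_min_normal (A : set V) phi mu k (x : nat -> V) xi g0
    (g : nat -> V -> R) G :
    0 < mu -> (forall u v, M u -> M v -> M (u - v)) -> M xi ->
    (forall J y, A y -> perturbed phi mu k x J xi <=
       perturbed phi mu k x J y + mu * 2^-1 ^+ J * `|y - xi|) ->
    frechet_supergradient_on M phi xi g0 ->
    (forall n, frechet_supergradient_on M (k n) (xi - x n) (g n)) ->
    (forall J h, `|G h - (g0 h + \sum_(n < J) mu * 2^-1 ^+ n.+1 * g n h)| <=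
       mu * `|h| * 2^-1 ^+ J) ->
  frechet_normal_ineq (A `&` M) xi (fun h => - G h).
Proof.
move=> mu0 MB Mxi xi_min phi_g0 k_g G_dist eps e0.
have [e2_gt0 e4_gt0] : 0 < eps / 2 /\ 0 < eps / 4 by rewrite !divr_gt0.
have /cvgr0_norm_le/(_ _ e4_gt0)[J _ /(_ J (leqnn J))] := cvg_half_pow mu.
rewrite gtr0_norm ?mulr_gt0 ?half_pow_gt0 // => J_small.
have pert_G := perturbed_supergradient J mu0 phi_g0 k_g.
apply: filterS (pert_G _ e2_gt0) => h pert_h [Ah Mxih].
have Mh : M h by rewrite -[h](addKr xi) addrC; exact: MB.
have := pert_h Mh; have := xi_min J _ Ah; rewrite [xi + h - xi]addrAC subrr add0r.
have := G_dist J h; rewrite ler_norml mulrAC => /andP[+ _].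
have : mu * 2^-1 ^+ J * `|h| <= eps / 4 * `|h| by rewrite ler_wpM2r.
lra.
Qed.

End Supergradient.

Lemma norm_smooth_approx (R : realType) (V : normedModType R) (M : set V) (eta : R) :
    Defs.subspace M -> separable_dual M -> 0 < eta ->
  exists k : V -> R,
  [/\ forall h, `|h| - eta <= k h <= `|h|,
      forall x y, k y <= k x + `|y - x| &
      forall x, exists g, [/\ scalar g, forall h, `|g h| <= `|h| &
        frechet_supergradient_on M k x g]].
Proof.
move=> sM sepD eta0.
have norm1 : norm_dominated 1 (fun x : V => `|x|) by move=> x; rewrite mul1r.
have [k [k_norm k_lip k_smooth]] :=
  sublinear_smooth_approx sM sepD (@norm_sublinear _ V) norm1 ltr01 eta0.
exists k; split=> // [x y|x]; first by have := k_lip x y; rewrite mul1r.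
have [g [lg g_le k_g]] := k_smooth x; exists g; split=> // h.
by rewrite -[leRHS]mul1r; apply: norm_dominated_abs lg _ h => h'; rewrite mul1r.
Qed.

Section SeparableRule.
Variables (R : realType) (V : completeNormedModType R) (M A : set V).
Hypotheses (sM : Defs.subspace M) (sepD : separable_dual M).
Hypotheses (clM : closed M) (clA : closed A).
Variables (N : V -> R) (C rho mu : R) (xb : V).
Hypotheses (sN : sublinear N) (NC : norm_dominated C N) (C_gt0 : 0 < C).
Hypotheses (rho_gt0 : 0 < rho) (mu_gt0 : 0 < mu) (Axb : A xb) (Mxb : M xb).
Hypothesis xb_min : forall x, A x -> M x -> `|x - xb| <= rho -> 0 <= N (x - xb).

Lemma separable_smooth_minimizer theta : 0 < theta -> exists (phi : V -> R)
    (k : nat -> V -> R) (x : nat -> V) (xi : V),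
  [/\ [/\ A xi, M xi & `|xi - xb| <= theta],
      forall J y, A y -> M y -> `|y - xb| <= rho ->
        perturbed phi mu k x J xi <= perturbed phi mu k x J y + mu * 2^-1 ^+ J * `|y - xi|,
      exists g, [/\ scalar g, forall h, g h <= N h & frechet_supergradient_on M phi xi g] &
      forall n, exists g, [/\ scalar g, forall h, `|g h| <= `|h| &
        frechet_supergradient_on M (k n) (xi - x n) g]].
Proof.
move=> theta0; have half0 := half_pow_gt0 R.
have [|k0 [k0_approx k0_lip k0_smooth]] := sublinear_smooth_approx
    (eta := theta * mu * 2^-1 ^+ 0 * 2^-1 ^+ 0 / 16) sM sepD sN NC C_gt0.
  by rewrite expr0 !mulr1 divr_gt0 // mulr_gt0.
have /choice[k k_spec] n := norm_smooth_approx (eta := theta * 2^-1 ^+ n / 4)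
  sM sepD (divr_gt0 (mulr_gt0 theta0 (half0 n)) (ltr0n _ 4)).
pose A' := A `&` M `&` closed_ball_ Num.norm xb rho.
have A'xb : A' xb by split=> //; rewrite /closed_ball_ /= subrr normr0 ltW.
have clA' : closed A' by apply: closedI; [exact: closedI|exact: closed_closed_ball_].
pose phi y := k0 (y - xb).
have phi_lip x y : phi y <= phi x + C * `|y - x|.
  by have := k0_lip (x - xb) (y - xb); rewrite opprB addrA subrK.
have phi_min y : A' y -> phi xb <= phi y + theta * mu * 2^-1 ^+ 0 * 2^-1 ^+ 0 / 16.
  move=> [[Ay My]]; rewrite /closed_ball_ /= distrC => /(xb_min Ay My).
  have /andP[+ _] := k0_approx (y - xb); have /andP[_] := k0_approx 0.
  by rewrite (sublinear0 sN) /phi subrr; lra.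
have [||x [xi [_ [[Axi Mxi] _] xib xi_min]]] := Borwein_Preiss
  clA' A'xb (ltW C_gt0) theta0 mu_gt0 phi_lip _ _ phi_min (k := k).
- by move=> n; have [] := k_spec n.
- by move=> n; have [] := k_spec n.
exists phi, k, x, xi; split=> // [J y Ay My y_rho||n].
- by apply: xi_min; do 2?split=> //; rewrite /closed_ball_ /= distrC.
- have [g [lg gN k0_g]] := k0_smooth (xi - xb); exists g; split=> //.
  exact: frechet_supergradient_shift.
- by have [_ _] := k_spec n; exact.
Qed.

Lemma separable_fuzzy_rule : exists x f, [/\ A x, M x & `|x - xb| <= mu] /\
  [/\ is_dual f, forall h, - f h <= N h + mu * `|h| &
      frechet_normal_ineq (A `&` M) x f].
Proof.
pose theta := Num.min rho mu / 2.
have theta0 : 0 < theta by rewrite divr_gt0 // lt_min rho_gt0.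
have [theta_rho theta_mu] : theta <= rho / 2 /\ theta <= mu / 2.
  by rewrite !ler_pM2r ?invr_gt0 // !ge_min !lexx orbT.
have [phi [k [x [xi [[Axi Mxi xib] xi_min [g0 [lg0 g0N phi_g0]] k_smooth]]]]] :=
  separable_smooth_minimizer theta0.
have /choice[g g_spec] := k_smooth.
have lg n : scalar (g n) by have [] := g_spec n.
have g_abs n h : `|g n h| <= `|h| by have [_ + _] := g_spec n; exact.
have k_g n : frechet_supergradient_on M (k n) (xi - x n) (g n) by have [] := g_spec n.
have [G lG G_dist] := geometric_series_scalar (ltW mu_gt0) lg0 lg g_abs.
have GN h : G h <= N h + mu * `|h|.
  have := G_dist 0%N h; rewrite big_ord0 addr0 expr0 mulr1 ler_norml.
  by have := g0N h; lra.
exists xi, (fun h => - G h); split; [split=> //; lra|split].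
- apply: is_dualN; apply: (dominated_is_dual lG (C := C + mu)) => h.
  by have := GN h; have := NC h; lra.
- by move=> h; rewrite opprK.
pose A' := [set y | A y /\ M y /\ `|y - xb| <= rho].
have A'_min J y : A' y -> perturbed phi mu k x J xi <=
    perturbed phi mu k x J y + mu * 2^-1 ^+ J * `|y - xi|.
  by move=> [Ay [My y_rho]]; exact: xi_min.
apply: frechet_normal_ineq_local
  (perturbed_min_normal mu_gt0 (subspaceB sM) Mxi A'_min phi_g0 k_g G_dist).
have r2_gt0 : 0 < rho / 2 by rewrite divr_gt0.
apply: filterS (nbhs0_le r2_gt0) => h h_rho [Ah Mh]; split=> //; split=> //; split=> //.
by rewrite addrAC; have := ler_normD (xi - xb) h; lra.
Qed.

End SeparableRule.

(** * Separable reduction *)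

Lemma closure_continuous (T U : topologicalType) (f : T -> U) (E : set T) (F : set U) :
  continuous f -> (forall x, E x -> closure F (f x)) ->
  forall x, closure E x -> closure F (f x).
Proof.
move=> cf EF x Ex B /nbhs_interior/(cf x) fB.
by have [y [Ey /= /EF]] := Ex _ fB; exact.
Qed.

Lemma closure_subspace (R : realType) (V : normedModType R) (E : set V) :
  E !=set0 -> (forall (a : rat) u v, E u -> E v -> E (ratr a *: u + v)) ->
  Defs.subspace (closure E).
Proof.
move=> [w Ew] Ecomb.
have comb a u v : closure E u -> closure E v -> closure E (a *: u + v).
  have cl_a u' v' b : E u' -> E v' -> closure E (b *: u' + v').
    move=> Eu Ev; apply: (@closure_continuous R V (fun b => b *: u' + v') (range ratr)).
    - by move=> x; apply: cvgD (cvg_cst _); exact: scalel_continuous.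
    - by move=> _ [r _ <-]; apply: subset_closure; exact: Ecomb.
    - move=> B /nbhs_interior/nbhs_singleton Bb.
      have [r [Br r_rat]] := dense_rat (ex_intro _ b Bb) (@open_interior _ B).
      by exists r; split=> //; exact: interior_subset.
  move=> Eu; apply: (closure_continuous (f := fun v' => a *: u + v')).
  - by move=> x; apply: cvgD (cvg_cst _) cvg_id.
  move=> v' Ev; apply: (closure_continuous (f := fun u' => a *: u' + v')) Eu => [x|u' Eu'].
    by apply: cvgD (cvg_cst _); exact: scaler_continuous.
  exact: cl_a.
split=> //; have := comb (-1) w w (subset_closure Ew) (subset_closure Ew).
by rewrite scaleN1r addNr.
Qed.

Section ClosedUnderWitnesses.
Variables (R : realType) (V : normedModType R) (I : countType).
Variables (w : I -> V -> seq V) (x0 : V).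

Definition closure_op (n : nat) (vs : seq V) : V :=
  match unpickle n : option (rat + I * nat) with
  | Some (inl a) => ratr a *: nth 0 vs 0 + nth 0 vs 1
  | Some (inr (i, k)) => nth 0 (w i (nth 0 vs 0)) k
  | None => 0
  end.

Fixpoint closure_eval (t : GenTree.tree nat) : V :=
  match t with
  | GenTree.Leaf _ => x0
  | GenTree.Node n ts => closure_op n (map closure_eval ts)
  end.

Definition closure_space : set V := closure (range closure_eval).

Lemma closure_eval_in t : closure_space (closure_eval t).
Proof. by apply: subset_closure; exists t. Qed.

Lemma closure_space_base : closure_space x0.
Proof. by apply: subset_closure; exists (GenTree.Leaf 0%N). Qed.

Lemma closure_space_dense x e : closure_space x -> 0 < e ->
  exists t, `|x - closure_eval t| < e.
Proof.
move=> Mx e0; have [_ [[t _ <-] xt]] := Mx _ (nbhsx_ballx x e e0).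
by exists t; move: xt; rewrite -ball_normE.
Qed.

Lemma closure_space_subspace : Defs.subspace closure_space.
Proof.
apply: closure_subspace; first by exists x0, (GenTree.Leaf 0%N).
move=> a _ _ [t1 _ <-] [t2 _ <-].
exists (GenTree.Node (pickle (inl a : rat + I * nat)) [:: t1; t2]) => //.
by rewrite /= /closure_op pickleK.
Qed.

Lemma closure_space_separable : separable_in closure_space.
Proof.
exists (fun n => if unpickle n is Some t then closure_eval t else x0); split=> [n|x Mx e].
  by case: unpickle => [t|]; [exact: closure_eval_in|exact: closure_space_base].
by move=> /(closure_space_dense Mx)[t xt]; exists (pickle t); rewrite pickleK.
Qed.

Lemma closure_space_witness i t v : v \in w i (closure_eval t) -> closure_space v.
Proof.
move=> vw; pose k := index v (w i (closure_eval t)).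
rewrite -[v](nth_index 0 vw) (_ : nth _ _ _ = closure_eval
  (GenTree.Node (pickle (inr (i, k) : rat + I * nat)) [:: t])).
  exact: closure_eval_in.
by rewrite /= /closure_op pickleK.
Qed.

End ClosedUnderWitnesses.

Section SeparableReduction.
Variables (R : realType) (V : normedModType R) (A : set V).
Variables (q : V -> R) (C : R).
Hypotheses (sq : sublinear q) (qC : norm_dominated C q).

(* An entry [(k, t, u)] stands for the constraint
   [xs (u - x) <= k.+1%:R^-1 * `|u - x|] taken with the multiplier [t]. *)
Local Notation entry := (nat * R * V)%type.

Definition cone_vec (x : V) (l : seq entry) : V :=
  \sum_(z <- l) z.1.2 *: (z.2 - x).
Definition cone_cost (x : V) (l : seq entry) : R :=
  \sum_(z <- l) z.1.2 * z.1.1.+1%:R^-1 * `|z.2 - x|.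
Definition admissible (n : nat -> nat) (x : V) (l : seq entry) : Prop :=
  forall z, z \in l -> [/\ 0 <= z.1.2, A z.2 & `|z.2 - x| < (n z.1.1).+1%:R^-1].
Definition feasible (n : nat -> nat) (x : V) : Prop :=
  forall l, admissible n x l -> 0 <= q (cone_vec x l) + cone_cost x l.
Definition infeasible (s : seq nat) (x : V) (l : seq entry) : Prop :=
  [/\ all (fun z => z.1.1 < size s)%N l, admissible (nth 0%N s) x l &
      q (cone_vec x l) + cone_cost x l < 0].

Definition admissible_rel (n : nat -> nat) (x : V) (c : V) (r : R) : Prop :=
  exists l, [/\ admissible n x l, c = cone_vec x l & r = cone_cost x l].

Lemma admissible_rel_cone n x : convex_cone_rel (admissible_rel n x).
Proof.
split.
- by exists [::]; rewrite /cone_vec /cone_cost !big_nil; split.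
- move=> _ _ _ _ [l [al -> ->]] [l' [al' -> ->]]; exists (l ++ l').
  rewrite /cone_vec /cone_cost !big_cat; split=> // z.
  by rewrite mem_cat => /orP[/al|/al'].
- move=> t _ _ t0 [l [al -> ->]]; exists [seq (z.1.1, t * z.1.2, z.2) | z <- l].
  split=> [z /mapP[z' /al[t0' Az' zz'] ->]||]; first by split=> //=; exact: mulr_ge0.
    by rewrite /cone_vec big_map scaler_sumr; apply: eq_bigr => z _; rewrite scalerA.
  by rewrite /cone_cost big_map mulr_sumr; apply: eq_bigr => z _; rewrite !mulrA.
Qed.

Lemma feasible_frechet_normal n x : feasible n x ->
  exists xs, [/\ is_dual xs, forall h, - xs h <= q h & frechet_normal_ineq A x xs].
Proof.
move=> feas; have pG c r : admissible_rel n x c r -> 0 <= q c + r.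
  by move=> [l [al -> ->]]; exact: feas.
have [y [ly yq yG]] := Hahn_Banach_cone sq (admissible_rel_cone n x) pG.
exists (fun h => - y h); split.
- by apply: is_dualN; apply: (dominated_is_dual ly (C := C)) => h; exact: le_trans (yq h) (qC h).
- by move=> h; rewrite opprK.
move=> eps /(ltr_add_invr)[k]; rewrite add0r => /ltW k_eps.
have r0 : 0 < (n k).+1%:R^-1 :> R by [].
apply: filterS (nbhs0_lt r0) => h hr Ah.
apply: (@le_trans _ _ (k.+1%:R^-1 * `|h|)); last by rewrite ler_wpM2r.
rewrite lerNl; apply: yG; exists [:: (k, 1, x + h)].
rewrite /cone_vec /cone_cost !big_seq1 /= scale1r mul1r [x + h - x]addrAC subrr add0r.
by split=> // z; rewrite inE => /eqP -> /=; rewrite [x + h - x]addrAC subrr add0r.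
Qed.

Lemma frechet_normal_admissible (M : set V) x f : scalar f ->
    (forall h, - f h <= q h) -> frechet_normal_ineq (A `&` M) x f ->
  exists n, forall l, admissible n x l -> (forall z, z \in l -> M z.2) ->
    0 <= q (cone_vec x l) + cone_cost x l.
Proof.
move=> lf fq fN.
have /choice[n n_spec] (k : nat) : exists n : nat, forall u, A u -> M u ->
    `|u - x| < n.+1%:R^-1 -> f (u - x) <= k.+1%:R^-1 * `|u - x|.
  have /fN/nbhs_norm0P[r /= /ltr_add_invr[n] + hr] : 0 < k.+1%:R^-1 :> R by [].
  rewrite add0r => nr; exists n => u Au Mu un.
  by apply: (hr (u - x)) (lt_trans un nr) _; rewrite addrC subrK.
exists n => l adm Ml; rewrite -lerBlDr sub0r; apply: le_trans (fq _).
rewrite lerN2 /cone_vec /cone_cost; elim: l adm Ml => [|z l IH] adm Ml.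
  by rewrite !big_nil (linear_form0 lf).
have [t0 Az zx] := adm z (mem_head _ _); rewrite !big_cons lf lerD //.
  by rewrite -mulrA ler_wpM2l // n_spec //; apply: Ml; exact: mem_head.
by apply: IH => z' zl; [apply: adm|apply: Ml]; rewrite inE zl orbT.
Qed.

Lemma infeasible_near s x l : infeasible s x l -> \forall y \near x, infeasible s y l.
Proof.
move=> [sl adm neg].
have adm_near : \forall y \near x, admissible (nth 0%N s) y l.
  elim: l adm {sl neg} => [|z l IH] adm; first exact: nearW.
  have [t0 Az zx] := adm z (mem_head _ _).
  have zy_near : \forall y \near x, `|z.2 - y| < (nth 0%N s z.1.1).+1%:R^-1.
    by apply: cvgr_lt zx; apply: cvg_norm; apply: cvgB; [exact: cvg_cst|exact: cvg_id].
  near=> y => z'; rewrite inE => /orP[/eqP ->|]; first by split=> //; near: y.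
  by move: z'; near: y; apply: IH => z' zl; apply: adm; rewrite inE zl orbT.
have vec_cvg : cone_vec y l @[y --> x] --> cone_vec x l.
  apply: cvg_big => [|z _]; first exact: add_continuous.
  by apply: cvgZl_tmp; apply: cvgB; [exact: cvg_cst|exact: cvg_id].
have cost_cvg : cone_cost y l @[y --> x] --> cone_cost x l.
  apply: cvg_big => [|z _]; first exact: add_continuous.
  by apply: cvgMl_tmp; apply: cvg_norm; apply: cvgB; [exact: cvg_cst|exact: cvg_id].
have neg_near : \forall y \near x, q (cone_vec y l) + cone_cost y l < 0.
  by apply: cvgr_lt neg; apply: cvgD cost_cvg; apply: cvg_comp vec_cvg _;
    exact: sublinear_continuous sq qC _.
by near=> y; split=> //; near: y.
Unshelve. all: by end_near. Qed.

(* A single witness that is valid on a whole ball around [d] when there is one: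
   uniformity over a ball is what lets a countable set serve all points of its
   closure. *)
Lemma uniform_witness : exists W : seq nat * nat -> V -> seq entry, forall s j d,
  (exists l, forall x, `|x - d| < j.+1%:R^-1 -> infeasible s x l) ->
  forall x, `|x - d| < j.+1%:R^-1 -> infeasible s x (W (s, j) d).
Proof.
have /choice[W W_spec] (i : seq nat * nat * V) : exists l,
    (exists l, forall x, `|x - i.2| < i.1.2.+1%:R^-1 -> infeasible i.1.1 x l) ->
    forall x, `|x - i.2| < i.1.2.+1%:R^-1 -> infeasible i.1.1 x l.
  have [[l hl]|no] := pselect (exists l, forall x,
    `|x - i.2| < i.1.2.+1%:R^-1 -> infeasible i.1.1 x l); first by exists l.
  by exists [::] => /no.
by exists (fun sj d => W (sj, d)) => s j d; exact: (W_spec (s, j, d)).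
Qed.

Variable xb : V.

Lemma separable_reduction : exists M : set V,
  [/\ Defs.subspace M, separable_in M, closed M, M xb &
   forall x f, M x -> scalar f -> (forall h, - f h <= q h) ->
     frechet_normal_ineq (A `&` M) x f ->
   exists xs, [/\ is_dual xs, forall h, - xs h <= q h & frechet_normal_ineq A x xs]].
Proof.
have [W W_spec] := uniform_witness.
pose w (i : seq nat * nat) (d : V) := [seq z.2 | z <- W i d].
pose M := closure_space w xb; exists M; split.
- exact: closure_space_subspace.
- exact: closure_space_separable.
- exact: closed_closure.
- exact: closure_space_base.
move=> x f Mx lf fq /(frechet_normal_admissible lf fq)[n feas_M].
apply: (@feasible_frechet_normal n) => l adm; rewrite leNgt; apply/negP => neg.
pose K := (\max_(z <- l) z.1.1).+1; pose s := mkseq n K.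
have nth_s k : (k < K)%N -> nth 0%N s k = n k by move=> ?; rewrite nth_mkseq.
have l_lt_K z : z \in l -> (z.1.1 < K)%N by move=> zl; rewrite ltnS; exact: leq_bigmax_seq.
have /infeasible_near/nbhs_normP[rho /= rho0 inf_l] : infeasible s x l.
  split=> // [|z zl]; last by rewrite nth_s ?l_lt_K //; exact: adm.
  by apply/allP => z /l_lt_K; rewrite size_mkseq.
have [j] := ltr_add_invr (divr_gt0 rho0 (ltr0n R 2)); rewrite add0r => j_rho.
have j0 : 0 < j.+1%:R^-1 :> R by [].
have [t xt] := closure_space_dense Mx j0; set d := closure_eval w xb t in xt.
have [/allP l'_s adm' neg'] : infeasible s x (W (s, j) d).
  apply: W_spec => //; exists l => y yd; apply: inf_l; rewrite /ball_ /=.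
  have := ler_distD d x y; rewrite [ `|d - y| ]distrC.
  by move: j_rho xt yd; move: (j.+1%:R^-1) => r; lra.
suff : 0 <= q (cone_vec x (W (s, j) d)) + cone_cost x (W (s, j) d) by rewrite leNgt neg'.
apply: feas_M => z zW; last first.
  by apply: (closure_space_witness (i := (s, j)) (t := t)); apply/mapP; exists z.
by have := adm' z zW; rewrite nth_s //; have := l'_s z zW; rewrite size_mkseq.
Qed.

End SeparableReduction.

Lemma frechet_normal_nrmP (R : realType) (V : normedModType R) (A : set V) x xs :
  frechet_normal (@nrm R V) A x xs <-> [/\ A x, is_dual xs & frechet_normal_ineq A x xs].
Proof.
split=> [[Ax [dxs xsA]]|[Ax dxs xsA]]; split=> //.
  move=> eps /xsA[d [d0 xs_d]]; apply: filterS (nbhs0_lt d0) => h hd Ah.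
  by have := xs_d _ Ah; rewrite /nrm [x + h - x]addrAC subrr add0r; exact.
split=> // eps /xsA/nbhs_norm0P[d /= d0 xs_d]; exists d; split=> // u Au ud.
by apply: (xs_d (u - x)) => //; rewrite addrC subrK.
Qed.

(** * The fuzzy multiplier rule in Asplund spaces *)

Theorem fuzzy_multiplier_rule (R : realType) (V : completeNormedModType R)
    (A : set V) (N : V -> R) (C mu : R) (xb : V) :
    asplund V -> closed A -> sublinear N -> norm_dominated C N -> 0 < mu -> A xb ->
    (\forall h \near (0 : V), A (xb + h) -> 0 <= N h) ->
  exists x xs, [/\ `|x - xb| <= mu, frechet_normal (@nrm R V) A x xs &
                   forall h, - xs h <= N h + mu * `|h|].
Proof.
move=> aV clA sN NC mu0 Axb /nbhs_norm0P[r /= r0 xb_min].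
have C0 : 0 < `|C| + 1 by rewrite ltr_wpDl.
have {}NC : norm_dominated (`|C| + 1) N.
  by apply: norm_dominatedW NC; rewrite (le_trans (ler_norm C)) // lerDl.
have sN_mu : sublinear (fun h => N h + mu * `|h|).
  exact: sublinearD sN (sublinearZ (ltW mu0) (@norm_sublinear _ V)).
have NC_mu : norm_dominated (`|C| + 1 + mu) (fun h => N h + mu * `|h|).
  by move=> h; rewrite mulrDl lerD2r.
have [M [sM sepM clM Mxb M_lift]] := separable_reduction A sN_mu NC_mu xb.
have r2_gt0 : 0 < r / 2 by rewrite divr_gt0.
have [|x [f [[Ax Mx xxb] [df fN fA]]]] := separable_fuzzy_rule sM (aV _ sM sepM)
  clM clA sN NC C0 r2_gt0 mu0 Axb Mxb.
  move=> x Ax _ xr; apply: xb_min; last by rewrite addrC subrK.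
  by apply: le_lt_trans xr _; rewrite ltr_pdivrMr // ltr_pMr // ltr1n.
have [xs [dxs xsN xsA]] := M_lift _ _ Mx df.1 fN fA.
by exists x, xs; split=> //; exact/frechet_normal_nrmP.
Qed.

(** * Products of Asplund spaces *)

HB.instance Definition _ (U V : puniformType) := Uniform.on (U * V)%type.

Lemma prod_cauchy_cvg (R : realType) (V W : completeNormedModType R)
    (F : set_system (V * W)%type) : ProperFilter F -> cauchy F -> cvg F.
Proof.
move=> FF /cauchyP Fc.
have cvg_fst : cvg (fst @ F).
  apply: cauchy_cvg; apply: cauchy_exP => e /Fc[x Fx]; exists x.1.
  by suff: F (fst @^-1` ball x.1 e) by []; apply: filterS Fx => y [].
have cvg_snd : cvg (snd @ F).
  apply: cauchy_cvg; apply: cauchy_exP => e /Fc[x Fx]; exists x.2.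
  by suff: F (snd @^-1` ball x.2 e) by []; apply: filterS Fx => y [].
apply/cvg_ex; exists (lim (fst @ F), lim (snd @ F)).
apply: cvg_trans (cvg_pair cvg_fst cvg_snd).
by apply: near_eq_cvg; apply: nearW; case.
Qed.

HB.instance Definition _ (R : realType) (V W : completeNormedModType R) :=
  Uniform_isComplete.Build (V * W)%type (@prod_cauchy_cvg R V W).

Section ProductNorm.
Variables (R : realType) (V W : normedModType R).
Implicit Types (z : V * W) (f : V * W -> R).

Lemma prod_norm_le z c : (`|z| <= c) = (`|z.1| <= c) && (`|z.2| <= c).
Proof. by rewrite prod_normE ge_max. Qed.

Lemma prod_norm_fst z : `|z.1| <= `|z|.
Proof. by have := lexx `|z|; rewrite {1}prod_norm_le => /andP[]. Qed.

Lemma prod_norm_snd z : `|z.2| <= `|z|.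
Proof. by have := lexx `|z|; rewrite {1}prod_norm_le => /andP[]. Qed.

Lemma prod_norm_le_add z : `|z| <= `|z.1| + `|z.2|.
Proof. by rewrite prod_norm_le lerDl lerDr !normr_ge0. Qed.

Lemma prod_norm_inl (u : V) : `|(u, 0 : W)| = `|u|.
Proof. by rewrite prod_normE /= normr0 max_l. Qed.

Lemma prod_norm_inr (v : W) : `|(0 : V, v)| = `|v|.
Proof. by rewrite prod_normE /= normr0 max_r. Qed.

Lemma scalar_inl f : scalar f -> scalar (fun u => f (u, 0)).
Proof.
move=> lf a u v; rewrite -lf; congr f.
by apply: injective_projections; rewrite /= ?scaler0 ?addr0.
Qed.

Lemma scalar_inr f : scalar f -> scalar (fun v => f (0, v)).
Proof.
move=> lf a u v; rewrite -lf; congr f.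
by apply: injective_projections; rewrite /= ?scaler0 ?addr0.
Qed.

Lemma linear_form_pair f u v : scalar f -> f (u, v) = f (u, 0) + f (0, v).
Proof.
move=> lf; rewrite -(linear_formD lf); congr f.
by apply: injective_projections; rewrite /= ?addr0 ?add0r.
Qed.

Lemma is_dual_inl f : is_dual f -> is_dual (fun u => f (u, 0)).
Proof.
move=> df; have [C _ fC] := is_dual_dominated df.
apply: (dominated_is_dual (scalar_inl df.1) (C := C)) => u.
by rewrite -prod_norm_inl; exact: fC.
Qed.

Lemma is_dual_inr f : is_dual f -> is_dual (fun v => f (0, v)).
Proof.
move=> df; have [C _ fC] := is_dual_dominated df.
apply: (dominated_is_dual (scalar_inr df.1) (C := C)) => v.
by rewrite -prod_norm_inr; exact: fC.
Qed.

Lemma is_dual_pair (f : V -> R) (g : W -> R) : is_dual f -> is_dual g ->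
  is_dual (fun z : V * W => f z.1 + g z.2).
Proof.
move=> df dg; have [C C0 fC] := is_dual_dominated df.
have [D D0 gD] := is_dual_dominated dg.
apply: (dominated_is_dual (C := C + D)) => [a u v|z]; first by rewrite /= df.1 dg.1; ring.
rewrite mulrDl lerD // (le_trans (fC _), le_trans (gD _)) // ler_pM2l //.
  exact: prod_norm_fst.
exact: prod_norm_snd.
Qed.

Lemma closed_setX (A : set V) (B : set W) : closed A -> closed B -> closed (A `*` B).
Proof.
by move=> clA clB; apply: closedI; apply: preimage_closed => // z _;
  [exact: cvg_fst|exact: cvg_snd].
Qed.

End ProductNorm.

Lemma subspace_image (R : realType) (V W : normedModType R) (L : {linear V -> W})
    (M : set V) : Defs.subspace M -> Defs.subspace (L @` M).
Proof.
move=> [M0 Mcomb]; split=> [|a _ _ [u Mu <-] [v Mv <-]].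
  by exists 0; rewrite ?linear0.
by exists (a *: u + v); rewrite ?linearP //; exact: Mcomb.
Qed.

Lemma separable_in_image (R : realType) (V W : normedModType R) (f : V -> W)
    (M : set V) : (forall u v, `|f u - f v| <= `|u - v|) ->
  separable_in M -> separable_in (f @` M).
Proof.
move=> f_le [d [Md d_dense]]; exists (f \o d); split=> [n|_ [u Mu <-] eps e0].
  by exists (d n).
by have [n un] := d_dense _ Mu _ e0; exists n; exact: le_lt_trans (f_le _ _) un.
Qed.

Lemma asplund_prod (R : realType) (V W : completeNormedModType R) :
  asplund V -> asplund W -> asplund (V * W)%type.
Proof.
move=> aV aW M sM sepM.
have sM1 := subspace_image (fst : {linear (V * W)%type -> V}) sM.
have sM2 := subspace_image (snd : {linear (V * W)%type -> W}) sM.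
have sep1 : separable_in (fst @` M).
  by apply: separable_in_image sepM => u v; exact: (prod_norm_fst (u - v)).
have sep2 : separable_in (snd @` M).
  by apply: separable_in_image sepM => u v; exact: (prod_norm_snd (u - v)).
have /(separable_dualP sM1)[f1 [df1 f1_dense]] := aV _ sM1 sep1.
have /(separable_dualP sM2)[f2 [df2 f2_dense]] := aW _ sM2 sep2.
apply/(separable_dualP sM).
exists (fun n z => let ij := odflt (0%N, 0%N) (unpickle n) in f1 ij.1 z.1 + f2 ij.2 z.2).
split=> [n|f df e e0]; first exact: is_dual_pair.
have e2_gt0 : 0 < e / 2 by rewrite divr_gt0.
have [i fi] := f1_dense _ (is_dual_inl df) _ e2_gt0.
have [j fj] := f2_dense _ (is_dual_inr df) _ e2_gt0.
exists (pickle (i, j)) => -[u v] Muv; rewrite pickleK /= (linear_form_pair _ _ df.1).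
rewrite opprD addrACA (le_trans (ler_normD _ _)) //.
have : e / 2 * `|u| <= e / 2 * `|(u, v)| by rewrite ler_pM2l // (prod_norm_fst (u, v)).
have : e / 2 * `|v| <= e / 2 * `|(u, v)| by rewrite ler_pM2l // (prod_norm_snd (u, v)).
have := fi u (ex_intro2 _ _ (u, v) Muv erefl); have := fj v (ex_intro2 _ _ (u, v) Muv erefl).
lra.
Qed.

Lemma asplund_real (R : realType) : asplund R^o.
Proof.
move=> M sM _; apply/(separable_dualP sM).
exists (fun n x => ratr (odflt 0 (unpickle n : option rat)) * x); split=> [n|f df e e0].
  set r := ratr _; split=> [a u v|x]; first by rewrite mulrDr mulrCA.
  by apply: cvgMl_tmp; exact: cvg_id.
have fE (x : R^o) : f x = f 1 * x by rewrite mulrC -(linear_formZ df.1) /GRing.scale /= mulr1.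
have [r] : exists r : rat, ratr r \in `](f 1), (f 1 + e)[ by apply: rat_in_itvoo; rewrite ltrDl.
rewrite in_itv /= => /andP[fr rf]; exists (pickle r) => x _.
by rewrite pickleK /= fE -mulrBl normrM ler_wpM2r // ler_norml; lra.
Qed.

Section ProductNormals.
Variables (R : realType) (V W : normedModType R).

Lemma frechet_normal_prod (A : set V) (B : set W) z xs :
  frechet_normal (@nrm R (V * W)%type) (A `*` B) z xs ->
  frechet_normal (@nrm R V) A z.1 (fun u => xs (u, 0)) /\
  frechet_normal (@nrm R W) B z.2 (fun v => xs (0, v)).
Proof.
move=> /frechet_normal_nrmP[[Az Bz] dxs xsAB].
split; apply/frechet_normal_nrmP; split=> //.
- exact: is_dual_inl.
- move=> eps /xsAB/nbhs_norm0P[d /= d0 xs_d].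
  apply: filterS (nbhs0_lt d0) => u ud Au; rewrite -(prod_norm_inl W).
  by apply: xs_d; rewrite /= ?prod_norm_inl //; split; rewrite /= ?addr0.
- exact: is_dual_inr.
- move=> eps /xsAB/nbhs_norm0P[d /= d0 xs_d].
  apply: filterS (nbhs0_lt d0) => v vd Bv; rewrite -(prod_norm_inr V).
  by apply: xs_d; rewrite /= ?prod_norm_inr //; split; rewrite /= ?addr0.
Qed.

Lemma frechet_normal_norm_le (n : V -> R) (A : set V) x xs :
  (forall v, `|v| <= n v) -> frechet_normal (@nrm R V) A x xs ->
  frechet_normal n A x xs.
Proof.
move=> n_ge [Ax [dxs xsA]]; split=> //; split=> // e e0.
have [d [d0 xs_d]] := xsA _ e0; exists d; split=> // u Au ud.
apply: le_trans (xs_d _ Au _) _; first exact: le_lt_trans (n_ge _) ud.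
by rewrite ler_pM2l //; exact: n_ge.
Qed.

Lemma sum_norm_ge (n1 : V -> R) (n2 : W -> R) :
  (forall u, `|u| <= n1 u) -> (forall v, `|v| <= n2 v) ->
  forall z : V * W, `|z| <= sum_norm n1 n2 z.
Proof.
by move=> n1_ge n2_ge z; apply: le_trans (prod_norm_le_add z) _; rewrite lerD.
Qed.

End ProductNormals.

(** * Frechet subgradients *)

Definition frechet_subgradient (R : realType) (V : normedModType R) (phi : V -> R)
    (x : V) (f : V -> R) : Prop :=
  is_dual f /\ forall eps, 0 < eps ->
    \forall h \near (0 : V), f h <= phi (x + h) - phi x + eps * `|h|.

Definition epi_on (R : realType) (V : normedModType R) (B : set V) (phi : V -> R) :
    set (V * R^o) :=
  [set z | B z.1 /\ phi z.1 <= z.2].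

Definition graph_on (R : realType) (V W : normedModType R) (B : set V) (g : V -> W) :
    set (V * W) :=
  [set z | B z.1 /\ z.2 = g z.1].

Section LipschitzGraphs.
Variables (R : realType) (V W : normedModType R).

Lemma lipschitz_shear_closed (B : set V) (D : set W) (g : V -> W) (L : R) :
  closed B -> closed D -> L.-lipschitz_B g ->
  closed [set z : V * W | B z.1 /\ D (z.2 - g z.1)].
Proof.
move=> clB clD gL; set S := [set z | _] => z /within_nbhs_proper Sz_proper.
pose F := within S (nbhs z).
have F_fst : fst @ F --> z.1 by apply: cvg_within_filter; exact: cvg_fst.
have F_snd : snd @ F --> z.2 by apply: cvg_within_filter; exact: cvg_snd.
have S_F : \forall y \near F, S y by exact: withinT.
have Bz : B z.1.
  by apply: closed_cvg _ clB _ _ F_fst; apply: filterS S_F => y [].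
have F_g : g y.1 @[y --> F] --> g z.1.
  apply/cvgrPdist_le => e e0; have L1_gt0 : 0 < `|L| + 1 by rewrite ltr_wpDl.
  near=> y; have [By _] : S y by near: y.
  apply: le_trans (gL (z.1, y.1) (conj Bz By)) _ => /=.
  apply: (@le_trans _ _ ((`|L| + 1) * `|z.1 - y.1|)).
    by rewrite ler_wpM2r // (le_trans (ler_norm L)) // lerDl.
  rewrite mulrC -ler_pdivlMr //; near: y.
  by apply: cvgr_dist_le F_fst _ _; rewrite divr_gt0.
split=> //; apply: closed_cvg _ clD _ _ (cvgB F_snd F_g).
by apply: filterS S_F => y [].
Unshelve. all: by end_near. Qed.

End LipschitzGraphs.

Lemma epi_on_closed (R : realType) (V : normedModType R) (B : set V) (phi : V -> R) L :
  closed B -> L.-lipschitz_B (phi : V -> R^o) -> closed (epi_on B phi).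
Proof.
move=> clB phiL; have := lipschitz_shear_closed clB (@closed_ge R 0) phiL.
by congr closed; apply/seteqP; split=> z [Bz]; rewrite /= subr_ge0.
Qed.

Lemma graph_on_closed (R : realType) (V W : normedModType R) (B : set V) (g : V -> W) L :
  closed B -> L.-lipschitz_B g -> closed (graph_on B g).
Proof.
move=> clB gL.
have cl0 : closed [set 0 : W].
  exact/accessible_closed_set1/hausdorff_accessible/norm_hausdorff.
have := lipschitz_shear_closed clB cl0 gL.
by congr closed; apply/seteqP; split=> z [Bz] /=; [move/subr0_eq|move=> ->; rewrite subrr].
Qed.

Section Subgradients.
Variables (R : realType) (V : normedModType R).
Implicit Types (phi f : V -> R) (x : V).

Lemma near0_scale (P : set V) (h : V) : (\forall k \near (0 : V), P k) ->
  \forall t \near (0 : R)^'+, P (t *: h).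
Proof.
move=> P0; have : t *: h @[t --> (0 : R)^'+] --> (0 : V).
  by apply: cvg_at_right_filter; rewrite -[X in _ --> X](scale0r h); exact: scalel_continuous.
by apply.
Qed.

Lemma frechet_normal_ineq_graph (W : normedModType R) (A : set (V * W)) z xs
    (g : V -> W) (L : R) :
    frechet_normal_ineq A z xs ->
    (\forall k \near (0 : V), `|g (z.1 + k) - g z.1| <= L * `|k|) ->
    (\forall k \near (0 : V), A (z.1 + k, z.2 + (g (z.1 + k) - g z.1))) ->
  forall eps, 0 < eps ->
    \forall k \near (0 : V), xs (k, g (z.1 + k) - g z.1) <= eps * `|k|.
Proof.
move=> xsA gL A_near eps e0; have L1_gt0 : 0 < `|L| + 1 by rewrite ltr_wpDl.
have /xsA/nbhs_norm0P[d /= d0 xs_d] : 0 < eps / (`|L| + 1) by rewrite divr_gt0.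
near=> k; set p := (k, _); have p_le : `|p| <= (`|L| + 1) * `|k|.
  have gk : `|g (z.1 + k) - g z.1| <= L * `|k| by near: k.
  rewrite prod_norm_le /=; apply/andP; split; first by rewrite ler_peMl // lerDr.
  by apply: le_trans gk _; rewrite ler_wpM2r // (le_trans (ler_norm L)) // lerDl.
apply: le_trans (xs_d p _ _) _ => /=.
- apply: le_lt_trans p_le _; rewrite mulrC -ltr_pdivlMr //; near: k.
  by apply: nbhs0_lt; rewrite divr_gt0.
- by rewrite /p; near: k.
- apply: le_trans (ler_wpM2l _ p_le) _; first by rewrite divr_ge0 // ltW.
  by rewrite mulrA divfK // gt_eqF.
Unshelve. all: by end_near. Qed.

Lemma lipschitz_near (W : normedModType R) (B : set V) (g : V -> W) (L : R) x :
  L.-lipschitz_B g -> nbhs x B ->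
  \forall k \near (0 : V), `|g (x + k) - g x| <= L * `|k|.
Proof.
move=> gL nB; have Bx := nbhs_singleton nB.
apply: filterS (iffLR (nbhs0P _ _) nB) => k Bk.
by have := gL (x + k, x) (conj Bk Bx); rewrite /= [x + k - x]addrAC subrr add0r.
Qed.

Lemma nbhs_closed_ball_ x y (r : R) :
  `|y - x| < r -> nbhs y (closed_ball_ Num.norm x r).
Proof.
move=> yr; apply/nbhs_normP; exists (r - `|y - x|) => [|u /=]; first by rewrite /= subr_gt0.
rewrite /closed_ball_ /= => yu; have := ler_distD y x u; rewrite [ `|x - y| ]distrC.
by move: (ltW yu); lra.
Qed.

Lemma frechet_subgradient_dominated phi x f L :
  (\forall k \near (0 : V), `|phi (x + k) - phi x| <= L * `|k|) ->
  frechet_subgradient phi x f -> norm_dominated L f.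
Proof.
move=> phiL [df f_sub] h; apply/ler_addgt0Pr => e e0.
have h_gt0 : 0 < `|h| + 1 by rewrite ltr_wpDl.
have e1 : 0 < e / (`|h| + 1) by rewrite divr_gt0.
near (0 : R)^'+ => t.
have t0 : 0 < t by near: t; exact: nbhs_right_gt.
have phi_t : `|phi (x + t *: h) - phi x| <= L * `|t *: h|.
  by near: t; exact: near0_scale phiL.
have : f (t *: h) <= phi (x + t *: h) - phi x + e / (`|h| + 1) * `|t *: h|.
  by near: t; exact: near0_scale (f_sub _ e1).
move: phi_t; rewrite (linear_formZ df.1) normrZ gtr0_norm // ler_norml => /andP[_ phi_t] f_t.
have : e / (`|h| + 1) * `|h| <= e by rewrite mulrAC ler_pdivrMr // ler_pM2l // lerDl.
by rewrite -(ler_pM2l t0) => e_h; rewrite -(ler_pM2l t0); lra.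
Unshelve. all: by end_near. Qed.

Lemma epi_on_normal_subgradient (B : set V) phi x t xs L :
    L.-lipschitz_B (phi : V -> R^o) -> nbhs x B ->
    frechet_normal (@nrm R (V * R^o)%type) (epi_on B phi) (x, t) xs -> xs (0, 1) < 0 ->
  frechet_subgradient phi x (fun h => (- xs (0, 1))^-1 * xs (h, 0)).
Proof.
move=> phiL nB /frechet_normal_nrmP[[_ /= phi_t] dxs xsA]; rewrite -oppr_gt0.
set lam := - _ => lam0; split.
  have [lxs cxs] := is_dual_inl dxs; split=> [a u v|h]; first by rewrite lxs; ring.
  by apply: cvgMl_tmp; exact: cxs.
move=> eps e0; have A_near : \forall k \near (0 : V),
    epi_on B phi (x + k, t + (phi (x + k) - phi x)).
  by apply: filterS (iffLR (nbhs0P _ _) nB) => k Bk; split=> //=; lra.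
apply: filterS (frechet_normal_ineq_graph xsA (lipschitz_near phiL nB) A_near
  (mulr_gt0 e0 lam0)) => k; set d : R^o := phi (x + k) - phi x.
rewrite (linear_form_pair _ _ dxs.1).
have -> : xs (0, d) = - (d * lam).
  rewrite mulrN opprK -(linear_formZ (scalar_inr dxs.1)) /GRing.scale /=.
  by rewrite mulr1.
by rewrite [_^-1 * _]mulrC ler_pdivrMr //; lra.
Qed.

Lemma is_dual_epi_normal f : is_dual f -> is_dual (fun z : V * R^o => f z.1 - z.2).
Proof.
move=> df; apply: (is_dual_pair df (g := fun s : R^o => - s)).
by apply: is_dualN; split=> [a u v //|s]; exact: cvg_id.
Qed.

Lemma subgradient_frechet_normal_epi phi x f : frechet_subgradient phi x f ->
  frechet_normal (@nrm R (V * R^o)%type) (epi phi) (x, phi x) (fun z => f z.1 - z.2).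
Proof.
move=> [df f_sub]; apply/frechet_normal_nrmP; split; first exact: lexx.
  exact: is_dual_epi_normal.
move=> eps e0; have /nbhs_norm0P[d /= d0 f_d] := f_sub _ e0.
apply: filterS (nbhs0_lt d0) => -[h s] /= hs_d; rewrite /epi /= => phi_s.
have hs_h := prod_norm_fst (h, s).
have := f_d h (le_lt_trans hs_h hs_d).
have : eps * `|h| <= eps * `|(h, s)| by rewrite ler_pM2l.
lra.
Qed.

End Subgradients.

(* A minimum of [phi + L |.|] over the epigraph of [phi], perturbed by the fuzzy
   rule, yields a normal whose last component stays close to [-1]. *)
Lemma exists_frechet_subgradient (R : realType) (V : completeNormedModType R)
    (phi : V -> R) (L : R) : asplund V -> L.-lipschitz_setT (phi : V -> R^o) ->
  exists x f, frechet_subgradient phi x f.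
Proof.
move=> aV phiL; pose N (z : V * R^o) : R := z.2 + `|L| * `|z.1|.
have sN : sublinear N.
  split=> [u v|s u s0]; rewrite /N /=; last by rewrite normrZ ger0_norm // /GRing.scale /=; ring.
  by have := ler_wpM2l (normr_ge0 L) (ler_normD u.1 v.1); lra.
have NC : norm_dominated (1 + `|L|) N.
  move=> z; have := ler_wpM2l (normr_ge0 L) (prod_norm_fst z).
  by have := prod_norm_snd z; rewrite /N ler_norml; lra.
have half0 : 0 < 2^-1 :> R by rewrite invr_gt0.
have [||[x t] [xs [_ nxs xsN]]] := @fuzzy_multiplier_rule R (V * R^o)%type
  (epi_on setT phi) N _ _ (0, phi 0) (asplund_prod aV (@asplund_real R))
  (epi_on_closed closedT phiL) sN NC half0.
- by split=> //=.
- near=> h => -[_ /= phi_h]; have := phiL (h.1, 0) (conj I I).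
  have := ler_wpM2r (normr_ge0 h.1) (ler_norm L); move: phi_h.
  by rewrite /N /= add0r subr0 ler_norml; lra.
exists x; have nT : nbhs x setT by exact: filterT.
eexists; apply: (epi_on_normal_subgradient phiL nT nxs).
have := xsN (0, -1); rewrite /N /= normr0 mulr0 addr0 prod_norm_inr normrN1.
have -> : ((0, -1) : V * R^o) = - (0, 1) by apply: injective_projections; rewrite /= ?oppr0.
by rewrite (linear_formN nxs.2.1.1) opprK; lra.
Unshelve. all: by end_near. Qed.

(** * Weak* sequential compactness *)

Section Subsequences.

Lemma subsequence_choice (P : nat -> nat -> Prop) :
  (forall k N, exists2 n, (N <= n)%N & P k n) ->
  exists phi : nat -> nat, (forall k, (phi k < phi k.+1)%N) /\ forall k, P k (phi k).
Proof.
move=> hP.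
have /choice[next next_spec] (i : nat * nat) : exists n, (i.2 <= n)%N /\ P i.1 n.
  by have [n] := hP i.1 i.2; exists n.
pose phi := fix phi k := next (k, if k is k'.+1 then (phi k').+1 else 0%N).
exists phi; split=> k; first by have [] := next_spec (k.+1, (phi k).+1).
by case: k => [|k]; [case: (next_spec (0%N, 0%N))|case: (next_spec (k.+1, (phi k).+1))].
Qed.

Lemma cvg_subsequence (phi : nat -> nat) : (forall k, (phi k < phi k.+1)%N) ->
  phi @ \oo --> \oo.
Proof.
move=> phi_incr; have phi_ge k : (k <= phi k)%N.
  by elim: k => // k IH; exact: leq_ltn_trans IH (phi_incr k).
by move=> A [N _ NA]; exists N => // k /= Nk; apply: NA; exact: leq_trans Nk (phi_ge k).
Qed.

Variables (R : realType) (u : nat -> R) (b : R).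
Hypothesis ub : forall n, `|u n| <= b.

Let u_bounded : has_ubound (range u) /\ has_lbound (range u).
Proof.
by split; [exists b|exists (- b)] => _ [n _ <-]; have := ub n; rewrite ler_norml => /andP[].
Qed.

Let infs_cvg : infs u @ \oo --> limn_inf u.
Proof. by have [uu lu] := u_bounded; apply/cvg_ex; eexists; exact: cvg_infs_sup. Qed.

Let infs_le n m : (n <= m)%N -> infs u n <= u m.
Proof.
move=> nm; have [_ [l lu]] := u_bounded; apply: ge_inf; last by exists m.
by exists l => _ [k _ <-]; apply: lu; exists k.
Qed.

Lemma near_ge_limn_inf e : 0 < e -> \forall n \near \oo, limn_inf u - e <= u n.
Proof.
move=> e0; have : limn_inf u - e < limn_inf u by rewrite ltrBlDr ltrDl.
by move=> /(cvgr_gt _ infs_cvg); apply: filterS => n /ltW/le_trans; apply; exact: infs_le.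
Qed.

Lemma exists_le_limn_inf e N : 0 < e -> exists2 n, (N <= n)%N & u n <= limn_inf u + e.
Proof.
move=> e0; have [_ lu] := u_bounded.
have infs_inf : has_inf (sdrop u N).
  split; first by exists (u N); exists N => /=.
  by have [l lb] := lu; exists l => _ [k _ <-]; apply: lb; exists k.
have [_ [n Nn <-] un] := inf_adherent e0 infs_inf; exists n => //.
apply: le_trans (ltW un) _; rewrite lerD2r.
apply: cvgr_to_ge infs_cvg _; exists N => // m /= Nm.
exact: nondecreasing_infs.
Qed.

End Subsequences.

Section WeakStarCompactness.
Variables (R : realType) (V : completeNormedModType R) (f : nat -> V -> R) (C : R).
Hypotheses (lf : forall n, scalar (f n)) (fC : forall n, norm_dominated C (f n)).

Local Notation p := (fun h => limn_inf (fun n => f n h)).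

Let f_le h n : `|f n h| <= C * `|h|.
Proof. exact: norm_dominated_abs (lf n) (fC n) h. Qed.

Lemma limn_inf_lipschitz : C.-lipschitz_setT (p : V -> R^o).
Proof.
suff p_le x y : p x <= p y + C * `|x - y|.
  move=> [x y] _ /=; have := p_le x y; have := p_le y x.
  by rewrite distrC ler_norml; lra.
apply/ler_addgt0Pr => e e0; have e2_gt0 : 0 < e / 2 by rewrite divr_gt0.
have [N _ fx] := near_ge_limn_inf (f_le x) e2_gt0.
have [n Nn fy] := exists_le_limn_inf (f_le y) N e2_gt0.
have := fx n Nn; have := fC n (x - y); rewrite (linear_formB (lf n)); lra.
Qed.

Section Subgradient.
Variables (x : V) (g : V -> R) (phi : nat -> nat).
Hypothesis g_sub : frechet_subgradient p x g.
Hypothesis phi_incr : forall k, (phi k < phi k.+1)%N.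
Hypothesis phi_le : forall k, f (phi k) x <= p x + harmonic k.

Lemma subgradient_lower_limit v e : 0 < e ->
  \forall n \near \oo, g v - e <= f (phi n) v.
Proof.
move=> e0; have v2 : 0 < `|v| + 2 by rewrite ltr_wpDl.
pose e1 := e / (`|v| + 2); have e1_gt0 : 0 < e1 by rewrite divr_gt0.
have eE : e = e1 * (`|v| + 2) by rewrite divfK // gt_eqF.
near (0 : R)^'+ => t; have t0 : 0 < t by near: t; exact: nbhs_right_gt.
have p_t : g (t *: v) <= p (x + t *: v) - p x + e1 * `|t *: v|.
  by near: t; exact: near0_scale (g_sub.2 _ e1_gt0).
have f_near : \forall n \near \oo, p (x + t *: v) - e1 * t <= f (phi n) (x + t *: v).
  exact: cvg_subsequence phi_incr _ (near_ge_limn_inf (f_le _) (mulr_gt0 e1_gt0 t0)).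
near=> n.
have f_t : p (x + t *: v) - e1 * t <= f (phi n) (x + t *: v) by near: n.
have harm_n : harmonic n <= e1 * t.
  near: n; apply: (cvgr_le _ (@cvg_harmonic R)); exact: mulr_gt0.
move: p_t f_t (phi_le n); rewrite (linear_formZ g_sub.1.1) normrZ (gtr0_norm t0).
rewrite (linear_formD (lf _)) (linear_formZ (lf _)) => {}p_t {}f_t f_x.
by rewrite -(ler_pM2l t0) eE; lra.
Unshelve. all: by end_near. Qed.

Lemma subgradient_subsequence_cvg v : f (phi n) v @[n --> \oo] --> g v.
Proof.
apply/cvgrPdist_le => e e0; near=> n.
have : g v - e <= f (phi n) v by near: n; exact: subgradient_lower_limit.
have : g (- v) - e <= f (phi n) (- v) by near: n; exact: subgradient_lower_limit.
by rewrite (linear_formN g_sub.1.1) (linear_formN (lf _)) ler_norml; lra.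
Unshelve. all: by end_near. Qed.

End Subgradient.

(* The lower limit of the [f n] is Lipschitz, hence has a Frechet subgradient at
   some [x]; a subsequence along which [f n x] tends to the lower limit
   converges pointwise to this subgradient. *)
Theorem weak_star_seq_compact : asplund V ->
  exists (phi : nat -> nat) (g : V -> R), [/\ forall k, (phi k < phi k.+1)%N,
    is_dual g & forall h, f (phi n) h @[n --> \oo] --> g h].
Proof.
move=> aV; have [x [g g_sub]] := exists_frechet_subgradient aV limn_inf_lipschitz.
have [phi [phi_incr phi_le]] : exists phi : nat -> nat,
    (forall k, (phi k < phi k.+1)%N) /\ forall k, f (phi k) x <= p x + harmonic k.
  apply: (@subsequence_choice (fun k n => f n x <= p x + harmonic k)) => k N.
  exact: (exists_le_limn_inf (f_le x) N (@harmonic_gt0 R k)).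
exists phi, g; split=> //; first exact: g_sub.1.
by move=> h; exact: (subgradient_subsequence_cvg g_sub phi_incr phi_le).
Qed.

End WeakStarCompactness.

(** * The fuzzy sum rule *)

Section Coupling.
Variables (R : realType) (W Y Z : normedModType R).

Lemma coupling_sublinear :
  sublinear (fun h : (W * Y) * (W * Z) => `|h.1.1 - h.2.1|).
Proof.
split=> [u v|t u t0] /=; first by rewrite opprD addrACA ler_normD.
by rewrite -scalerBr normrZ ger0_norm.
Qed.

Lemma coupling_le (h : (W * Y) * (W * Z)) : `|h.1.1 - h.2.1| <= 2 * `|h|.
Proof.
have := le_trans (prod_norm_fst h.1) (prod_norm_fst h).
have := le_trans (prod_norm_fst h.2) (prod_norm_snd h).
by have := ler_normB h.1.1 h.2.1; lra.
Qed.

End Coupling.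

Section FuzzySumRule.
Variables (R : realType) (W : completeNormedModType R) (phi psi : W -> R).
Variables (x : W) (f : W -> R) (r L eps : R).
Hypotheses (aW : asplund W) (r_gt0 : 0 < r) (L_gt0 : 0 < L) (eps_gt0 : 0 < eps).

Local Notation B := (closed_ball_ Num.norm x r).
Local Notation T := (W * R^o)%type.

Hypothesis phiL : L.-lipschitz_B (phi : W -> R^o).
Hypothesis psiL : L.-lipschitz_B (psi : W -> R^o).
Hypothesis f_sub : frechet_subgradient (phi \+ psi) x f.

(* The arguments of [phi] and [psi] move independently; the last term pays for
   this, since [psi] is [L]-Lipschitz. *)
Definition decoupled_gap (h : T * T) : R :=
  h.1.2 + h.2.2 - f h.1.1 + eps * `|h.1.1| + L * `|h.1.1 - h.2.1|.

Let lf : scalar f := f_sub.1.1.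

Lemma decoupled_gap_sublinear : sublinear decoupled_gap.
Proof.
apply: sublinearD (sublinearZ (ltW L_gt0) (@coupling_sublinear _ _ _ _)).
apply: sublinearD (sublinearZ (ltW eps_gt0) (sublinear_comp
  (fst \o fst : {linear (T * T)%type -> W}) (@norm_sublinear _ W))).
by apply: scalar_sublinear => t u v; rewrite /= lf /GRing.scale /=; ring.
Qed.

Lemma decoupled_gap_dominated : exists C, norm_dominated C decoupled_gap.
Proof.
have [C C0 fC] := is_dual_dominated f_sub.1.
exists (2 + C + eps + L * 2) => h; rewrite /decoupled_gap.
have h1_le := prod_norm_fst h; have h2_le := prod_norm_snd h.
have := prod_norm_snd h.1; have := prod_norm_snd h.2; rewrite !ler_norml.
have h11_le : `|h.1.1| <= `|h| := le_trans (prod_norm_fst h.1) h1_le.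
have := norm_dominated_abs lf fC h.1.1; rewrite ler_norml.
have := ler_wpM2l (ltW C0) h11_le; have := ler_wpM2l (ltW eps_gt0) h11_le.
by have := ler_wpM2l (ltW L_gt0) (coupling_le h); lra.
Qed.

Lemma decoupled_gap_near_ge0 : \forall h \near (0 : T * T),
  (epi_on B phi `*` epi_on B psi) ((x, phi x, (x, psi x)) + h) -> 0 <= decoupled_gap h.
Proof.
have /nbhs_norm0P[d /= d0 f_d] := f_sub.2 _ eps_gt0.
apply/nbhs_norm0P; exists d => //= h hd [[/= B1 phi_h] [/= B2 psi_h]].
have := f_d h.1.1 (le_lt_trans (le_trans (prod_norm_fst h.1) (prod_norm_fst h)) hd).
have := @psiL (x + h.1.1, x + h.2.1) (conj B1 B2).
rewrite /decoupled_gap /= opprD addrACA subrr add0r ler_norml.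
by move: phi_h psi_h; lra.
Qed.

Lemma decoupled_normals mu : 0 < mu -> exists (z : T * T) (xs : T * T -> R),
  [/\ `|z - (x, phi x, (x, psi x))| <= mu, is_dual xs,
      frechet_normal (@nrm R T) (epi_on B phi) z.1 (fun h => xs (h, 0)),
      frechet_normal (@nrm R T) (epi_on B psi) z.2 (fun h => xs (0, h)) &
      forall h, - xs h <= decoupled_gap h + mu * `|h| ].
Proof.
move=> mu0; have [C NC] := decoupled_gap_dominated.
have clB : closed B by exact: closed_closed_ball_.
have clA := closed_setX (epi_on_closed clB phiL) (epi_on_closed clB psiL).
have aT : asplund T := asplund_prod aW (@asplund_real R).
have Bx : B x by rewrite /closed_ball_ /= subrr normr0 ltW.
have [|z [xs [z_mu nxs xsN]]] := @fuzzy_multiplier_rule R (T * T)%type _ _ C mu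
  (x, phi x, (x, psi x)) (asplund_prod aT aT) clA decoupled_gap_sublinear NC mu0 _
  decoupled_gap_near_ge0; first by split; split=> /=.
have [phi_normal psi_normal] := frechet_normal_prod nxs.
by exists z, xs; split=> //; exact: nxs.2.1.
Qed.

Lemma decoupled_subgradients mu : 0 < mu -> mu < r -> mu < 1 ->
  exists (x1 x2 : W) (f1 f2 : W -> R) (c1 c2 : R),
  [/\ `|x1 - x| <= mu /\ `|x2 - x| <= mu,
      frechet_subgradient phi x1 f1 /\ frechet_subgradient psi x2 f2,
      `|c1 - 1| <= mu /\ `|c2 - 1| <= mu &
      forall h, `|c1 * f1 h + c2 * f2 h - f h| <= (eps + mu) * `|h|].
Proof.
move=> mu0 mu_r mu1; have [[[x1 t1] [x2 t2]] [xs [z_mu dxs phi_normal psi_normal xsN]]] :=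
  decoupled_normals mu0.
have [x1_mu x2_mu] : `|x1 - x| <= mu /\ `|x2 - x| <= mu.
  by move: z_mu; rewrite !prod_norm_le /= => /andP[/andP[-> _] /andP[-> _]].
have nB y : `|y - x| <= mu -> nbhs y B.
  by move=> y_mu; apply: nbhs_closed_ball_; exact: le_lt_trans y_mu mu_r.
have xs_vertical (h : T * T) : h.1.1 = 0 -> h.2.1 = 0 ->
    `|- xs h - (h.1.2 + h.2.2)| <= mu * `|h|.
  move=> h11_0 h21_0; have := xsN h; have := xsN (- h).
  rewrite (linear_formN dxs.1) normrN /decoupled_gap /= h11_0 h21_0 !oppr0 !addr0 normr0.
  rewrite (linear_form0 lf) => xs_ge xs_le; rewrite ler_norml; lra.
pose c1 := - xs (0, 1, 0); pose c2 := - xs (0, (0, 1)).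
have unit_norm : `|(0, 1) : T| = 1 by rewrite prod_norm_inr normr1.
have c1_mu : `|c1 - 1| <= mu.
  by have := xs_vertical (0, 1, 0); rewrite prod_norm_inl unit_norm mulr1 /= addr0; exact.
have c2_mu : `|c2 - 1| <= mu.
  by have := xs_vertical (0, (0, 1)); rewrite prod_norm_inr unit_norm mulr1 /= add0r; exact.
have [c1_gt0 c2_gt0] : 0 < c1 /\ 0 < c2 by move: c1_mu c2_mu; rewrite !ler_norml; lra.
exists x1, x2, (fun h => c1^-1 * xs (h, 0, 0)), (fun h => c2^-1 * xs (0, (h, 0))), c1, c2.
split=> //.
  split; [apply: (epi_on_normal_subgradient phiL (nB _ x1_mu) phi_normal)|
          apply: (epi_on_normal_subgradient psiL (nB _ x2_mu) psi_normal)];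
    by rewrite -oppr_gt0.
have sum_ge k : - (xs (k, 0, 0) + xs (0, (k, 0)) - f k) <= (eps + mu) * `|k|.
  have := xsN (k, 0, (k, 0)); rewrite (linear_form_pair _ _ dxs.1) /decoupled_gap /=.
  by rewrite subrr normr0 prod_normE /= !prod_norm_inl maxxx; lra.
move=> h; rewrite !mulVKf ?gt_eqF //.
have := sum_ge h; have := sum_ge (- h).
have := scalar_inl (scalar_inl dxs.1); have := scalar_inl (scalar_inr dxs.1) => l2 l1.
by rewrite (linear_formN l1) (linear_formN l2) (linear_formN lf) normrN ler_norml; lra.
Qed.

End FuzzySumRule.

Theorem fuzzy_sum_rule (R : realType) (W : completeNormedModType R)
    (phi psi : W -> R) (x : W) (f : W -> R) (r L eps : R) :
    asplund W -> 0 < r -> 0 < L -> 0 < eps ->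
    L.-lipschitz_(closed_ball_ Num.norm x r) (phi : W -> R^o) ->
    L.-lipschitz_(closed_ball_ Num.norm x r) (psi : W -> R^o) ->
    frechet_subgradient (phi \+ psi) x f ->
  exists (x1 x2 : W) (f1 f2 : W -> R),
  [/\ `|x1 - x| <= eps /\ `|x2 - x| <= eps,
      frechet_subgradient phi x1 f1, frechet_subgradient psi x2 f2 &
      forall h, `|f1 h + f2 h - f h| <= eps * `|h|].
Proof.
move=> aW r0 L0 eps0 phiL psiL f_sub.
pose mu := Num.min (Num.min (eps / 2 / (1 + 2 * L)) (1 / 2)) (r / 2).
have L1_gt0 : 0 < 1 + 2 * L by rewrite addr_gt0 // mulr_gt0.
have mu0 : 0 < mu by rewrite !lt_min !divr_gt0.
have [mu_eps mu_half mu_r] : [/\ mu <= eps / 2 / (1 + 2 * L), mu <= 1 / 2 & mu <= r / 2].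
  by rewrite !ge_min !lexx !orbT.
have mu_lt_r : mu < r by apply: le_lt_trans mu_r _; lra.
have [|x1 [x2 [f1 [f2 [c1 [c2 [[x1_mu x2_mu] [f1_sub f2_sub] [c1_mu c2_mu] f_sum]]]]]]] :=
  decoupled_subgradients aW r0 L0 (divr_gt0 eps0 (ltr0n _ 2)) phiL psiL f_sub mu0 mu_lt_r.
  by apply: le_lt_trans mu_half _; lra.
move: mu_eps; rewrite ler_pdivlMr // => mu_eps.
have mu_le_eps : mu <= eps by have := mulr_gt0 mu0 L0; lra.
exists x1, x2, f1, f2; split=> //.
  by split; [apply: le_trans x1_mu _|apply: le_trans x2_mu _].
have f_le y g (phi' : W -> R) : `|y - x| <= mu ->
    L.-lipschitz_(closed_ball_ Num.norm x r) (phi' : W -> R^o) ->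
    frechet_subgradient phi' y g -> forall h, `|g h| <= L * `|h|.
  move=> y_mu phi'L g_sub; apply: norm_dominated_abs g_sub.1.1 _.
  apply: frechet_subgradient_dominated (lipschitz_near phi'L _) g_sub.
  by apply: nbhs_closed_ball_; exact: le_lt_trans y_mu mu_lt_r.
move=> h; have := f_sum h; rewrite mulrDl => f_sum_h.
have c_le c (g : R) : `|c - 1| <= mu -> `|g| <= L * `|h| -> `|(c - 1) * g| <= mu * (L * `|h|).
  by move=> c_mu g_le; rewrite normrM ler_pM.
have := c_le _ _ c1_mu (f_le _ _ _ x1_mu phiL f1_sub h).
have := c_le _ _ c2_mu (f_le _ _ _ x2_mu psiL f2_sub h).
have : mu * (1 + 2 * L) * `|h| <= eps / 2 * `|h| by rewrite ler_wpM2r.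
by move: f_sum_h; rewrite !ler_norml; lra.
Qed.

(** * Limiting subgradients of scalarizations *)

Lemma cvg_close (R : realType) (V : normedModType R) (u w : nat -> V) (l : V)
    (e : nat -> R) :
  (forall n, `|u n - w n| <= e n) -> e @ \oo --> 0 -> w @ \oo --> l -> u @ \oo --> l.
Proof.
move=> uw e_cvg0 wl; rewrite -[l]add0r; have -> : u = (u - w) + w by rewrite subrK.
apply: cvgD wl; apply: norm_cvg0; apply: squeeze_cvgr (cvg_cst 0) e_cvg0.
by apply: nearW => n; rewrite normr_ge0 uw.
Qed.

Section WeakStarLimits.
Variables (R : realType) (V : normedModType R) (f : nat -> V -> R) (g : V -> R) (C : R).
Hypotheses (lf : forall n, scalar (f n)) (fC : forall n, norm_dominated C (f n)).
Hypothesis f_cvg : forall v, f n v @[n --> \oo] --> g v.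

Lemma weak_star_dominated : norm_dominated C g.
Proof. by move=> v; apply: cvgr_to_le (@f_cvg v) _; apply: nearW => n; exact: fC. Qed.

Lemma weak_star_eval_cvg (u : nat -> V) l : u @ \oo --> l ->
  f n (u n) @[n --> \oo] --> g l.
Proof.
move=> ul; apply: (cvg_close (V := R^o) (e := fun n => C * `|u n - l|) _ _ (@f_cvg l)).
  by move=> n; rewrite -(linear_formB (lf n)); exact: norm_dominated_abs (lf n) (fC n) _.
rewrite -[X in _ --> X](mulr0 C); apply: cvgMl_tmp; apply/norm_cvg0P.
by rewrite -[X in _ --> X](subrr l); apply: cvgB ul (cvg_cst l).
Qed.

End WeakStarLimits.

Definition compact_quotients (R : realType) (W Z : normedModType R) (g : W -> Z) (wb v : W) :=
  forall (w : nat -> W) (t : nat -> R),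
    w @ \oo --> wb -> (forall k, 0 < t k) -> t @ \oo --> (0 : R) ->
  exists (phi : nat -> nat) (l : Z), (forall k, (phi k < phi k.+1)%N) /\
    (t (phi k))^-1 *: (g (w (phi k) + t (phi k) *: v) - g (w (phi k))) @[k --> \oo] --> l.

Section StrictlyLipschitzScalarization.
Variables (R : realType) (W Z : normedModType R) (nW : W -> R) (g : W -> Z) (wb : W).
Hypothesis g_strict : strictly_lipschitz nW g wb.
Variables (xi : nat -> Z -> R) (C : R) (w : nat -> W) (c : nat -> W -> R).
Hypotheses (lxi : forall n, scalar (xi n)) (xiC : forall n, norm_dominated C (xi n)).
Hypothesis xi_cvg0 : forall z, xi n z @[n --> \oo] --> 0.
Hypothesis w_cvg : w @ \oo --> wb.
Hypothesis c_sub : forall n, frechet_subgradient (xi n \o g) (w n) (c n).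

Lemma subgradient_le_quotient n v : exists t, [/\ 0 < t, t <= harmonic n &
  c n v <= xi n (t^-1 *: (g (w n + t *: v) - g (w n))) + harmonic n * `|v|].
Proof.
have [[lc _] c_le] := c_sub n; have harm0 := @harmonic_gt0 R n.
near (0 : R)^'+ => t; have t0 : 0 < t by near: t; exact: nbhs_right_gt.
exists t; split=> //; first by near: t; exact: nbhs_right_le.
have : c n (t *: v) <= (xi n \o g) (w n + t *: v) - (xi n \o g) (w n) + harmonic n * `|t *: v|.
  by near: t; exact: near0_scale (c_le _ harm0).
rewrite (linear_formZ lc) (linear_formZ (lxi n)) (linear_formB (lxi n)) normrZ gtr0_norm //=.
by move=> c_t; rewrite -(ler_pM2l t0) mulrDr mulVKf ?gt_eqF // [t * (harmonic _ * _)]mulrCA.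
Unshelve. all: by end_near. Qed.

(* Along a subsequence violating the bound, the difference quotients of [g]
   would converge, and the [xi n] tend to [0] uniformly on convergent
   sequences. *)
Lemma subgradient_upper_limit v : compact_quotients g wb v ->
  forall e, 0 < e -> \forall n \near \oo, c n v <= e.
Proof.
move=> v_compact e e0; apply: contrapT => not_near.
have [psi [psi_incr psi_gt]] : exists psi : nat -> nat,
    (forall k, (psi k < psi k.+1)%N) /\ forall k, e < c (psi k) v.
  apply: (@subsequence_choice (fun _ n => e < c n v)) => _ N; apply: contrapT => no.
  apply: not_near; exists N => // n /= Nn; rewrite leNgt; apply/negP => cn.
  by apply: no; exists n.
have /choice[t t_spec] n := subgradient_le_quotient n v.
have t_cvg0 : t @ \oo --> (0 : R).
  apply: squeeze_cvgr (cvg_cst 0) cvg_harmonic; apply: nearW => n.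
  by have [/ltW -> ->] := t_spec n.
have psi_oo := cvg_subsequence psi_incr.
have [|||phi [l [phi_incr quotient_cvg]]] := v_compact (w \o psi) (t \o psi).
- exact: cvg_comp psi_oo w_cvg.
- by move=> k; have [] := t_spec (psi k).
- exact: cvg_comp psi_oo t_cvg0.
have m_oo : psi \o phi @ \oo --> \oo := cvg_comp _ _ (cvg_subsequence phi_incr) psi_oo.
have xi_quotient := weak_star_eval_cvg (fun n => lxi _) (fun n => xiC _)
  (fun z => cvg_comp _ _ m_oo (@xi_cvg0 z)) quotient_cvg.
have harm_v : harmonic (psi (phi k)) * `|v| @[k --> \oo] --> 0.
  rewrite -[X in _ --> X](mul0r `|v|); apply: cvgMr_tmp.
  exact: cvg_comp m_oo (@cvg_harmonic R).
suff : e <= 0 + 0 by rewrite addr0 leNgt e0.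
apply: cvgr_to_ge (cvgD xi_quotient harm_v) _; apply: nearW => k.
by apply: le_trans (ltW (psi_gt (phi k))) _; have [] := t_spec (psi (phi k)).
Qed.

Lemma scalarized_subgradient_cvg0 v : c n v @[n --> \oo] --> 0.
Proof.
have [_ [V0 [V0_nbhs V0_compact]]] := g_strict.
near (0 : R)^'+ => s; have s0 : 0 < s by near: s; exact: nbhs_right_gt.
have Vs : compact_quotients g wb (s *: v).
  by apply: V0_compact; near: s; exact: near0_scale.
have VNs : compact_quotients g wb (s *: - v).
  by apply: V0_compact; near: s; exact: near0_scale.
apply/cvgr0Pnorm_le => e e0; have se_gt0 := mulr_gt0 s0 e0.
near=> n; have lc := (c_sub n).1.1.
have : c n (s *: v) <= s * e by near: n; exact: subgradient_upper_limit Vs _ se_gt0.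
have : c n (s *: - v) <= s * e by near: n; exact: subgradient_upper_limit VNs _ se_gt0.
rewrite !(linear_formZ lc) (linear_formN lc) !ler_pM2l // ler_norml.
by move=> cN_le c_le; apply/andP; split=> //; lra.
Unshelve. all: by end_near. Qed.

End StrictlyLipschitzScalarization.

Lemma lipschitz_onS (R : realType) (V W : normedModType R) (g : V -> W) (L : R)
    (A B : set V) : A `<=` B -> L.-lipschitz_B g -> L.-lipschitz_A g.
Proof. by move=> AB gL [u v] [/AB Bu /AB Bv]; exact: gL (u, v) (conj Bu Bv). Qed.

Lemma lipschitz_sublinear_comp (R : realType) (V W : normedModType R) (p : W -> R)
    (g : V -> W) (C L : R) (B : set V) : 0 <= C -> sublinear p -> norm_dominated C p ->
  L.-lipschitz_B g -> (C * L).-lipschitz_B (p \o g : V -> R^o).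
Proof.
move=> C0 sp pC gL [u v] Buv /=; have p_le a b : p a <= p b + C * `|a - b|.
  by rewrite addrC -lerBlDr; apply: le_trans (pC _); rewrite lerBlDr -{1}(subrK b a) sp.1.
have := p_le (g u) (g v); have := p_le (g v) (g u).
have := ler_wpM2l C0 (gL (u, v) Buv); rewrite mulrA [ `|g v - _| ]distrC /=.
by rewrite ler_norml; lra.
Qed.

Lemma lipschitz_on_nbhs_continuous (R : realType) (V W : normedModType R) (g : V -> W)
    (L : R) (B : set V) x : L.-lipschitz_B g -> nbhs x B -> {for x, continuous g}.
Proof.
move=> gL Bx; apply: (lipschitz_at_continuous (C := L)).
by apply: filterS (Bx) => u Bu; exact: gL (u, x) (conj Bu (nbhs_singleton Bx)).
Qed.

Lemma closed_ball_sub_center (R : realType) (V : normedModType R) (x y : V) (r s : R) :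
  `|y - x| + s <= r -> closed_ball_ Num.norm y s `<=` closed_ball_ Num.norm x r.
Proof.
rewrite /closed_ball_ => sr u /= us; have := ler_distD y x u.
by rewrite [ `|x - y| ]distrC; lra.
Qed.

Section ScalarizationRobustness.
Variables (R : realType) (W : completeNormedModType R) (Z : normedModType R).
Variables (nW : W -> R) (g : W -> Z) (wb : W) (r L C : R).
Hypotheses (aW : asplund W) (nW_ge : forall v, `|v| <= nW v).
Hypotheses (r_gt0 : 0 < r) (L_gt0 : 0 < L) (C_gt0 : 0 < C).
Hypothesis gL : L.-lipschitz_(closed_ball_ Num.norm wb r) g.
Hypothesis g_strict : strictly_lipschitz nW g wb.

Variables (zn : nat -> Z -> R) (zs : Z -> R) (w : nat -> W) (an : nat -> W -> R) (a : W -> R).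
Hypotheses (lzn : forall n, scalar (zn n)) (znC : forall n, norm_dominated C (zn n)).
Hypotheses (dzs : is_dual zs) (zn_cvg : forall z, zn n z @[n --> \oo] --> zs z).
Hypotheses (w_near : forall n, `|w n - wb| <= r / 2) (w_cvg : w @ \oo --> wb).
Hypothesis an_sub : forall n, frechet_subgradient (zn n \o g) (w n) (an n).
Hypotheses (da : is_dual a) (an_cvg : forall v, an n v @[n --> \oo] --> a v).

Let zsC : norm_dominated C zs := weak_star_dominated znC zn_cvg.

Let xi n z := zn n z - zs z.

Let lxi n : scalar (xi n).
Proof. by move=> t u v; rewrite /xi lzn dzs.1 /GRing.scale /=; ring. Qed.

Let xiC n : norm_dominated (2 * C) (xi n).
Proof.
move=> z; have := znC n z; have := norm_dominated_abs dzs.1 zsC z.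
by rewrite /xi ler_norml; lra.
Qed.

Let xi_cvg0 z : xi n z @[n --> \oo] --> 0.
Proof. by rewrite -[X in _ --> X](subrr (zs z)); apply: cvgB (@zn_cvg z) (cvg_cst _). Qed.

Lemma scalarization_split n : exists (x1 x2 : W) (f1 f2 : W -> R),
  [/\ `|x1 - w n| <= harmonic n /\ `|x2 - w n| <= harmonic n,
      frechet_subgradient (zs \o g) x1 f1, frechet_subgradient (xi n \o g) x2 f2 &
      forall h, `|f1 h + f2 h - an n h| <= harmonic n * `|h|].
Proof.
have CL_gt0 : 0 < 2 * C * L by rewrite !mulr_gt0.
have gLn : L.-lipschitz_(closed_ball_ Num.norm (w n) (r / 2)) g.
  have ball_sub : closed_ball_ Num.norm (w n) (r / 2) `<=` closed_ball_ Num.norm wb r.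
    by apply: closed_ball_sub_center; have := w_near n; lra.
  exact: lipschitz_onS ball_sub gL.
apply: (fuzzy_sum_rule aW (divr_gt0 r_gt0 (ltr0n _ 2)) CL_gt0 (@harmonic_gt0 R n)).
- apply: lipschitz_sublinear_comp (scalar_sublinear dzs.1) _ gLn; first by rewrite mulr_ge0 // ltW.
  by apply: norm_dominatedW zsC; rewrite ler_peMl ?ler1n ?ltW.
- by apply: lipschitz_sublinear_comp (scalar_sublinear (lxi n)) (xiC n) gLn;
    rewrite mulr_ge0 // ltW.
- have -> : (zs \o g) \+ (xi n \o g) = zn n \o g by apply/funext => u; rewrite /xi /= subrKC.
  exact: an_sub.
Qed.

Theorem scalarized_limiting_subdiff : limiting_subdiff nW (zs \o g) wb a.
Proof.
have /choice[x1 /choice[x2 /choice[f1 /choice[f2 split_spec]]]] := scalarization_split.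
have x1_cvg : x1 @ \oo --> wb.
  by apply: cvg_close cvg_harmonic w_cvg => n; have [[]] := split_spec n.
have x2_cvg : x2 @ \oo --> wb.
  by apply: cvg_close cvg_harmonic w_cvg => n; have [[]] := split_spec n.
have f1_sub n : frechet_subgradient (zs \o g) (x1 n) (f1 n) by have [] := split_spec n.
have f2_sub n : frechet_subgradient (xi n \o g) (x2 n) (f2 n) by have [] := split_spec n.
have f2_cvg0 := scalarized_subgradient_cvg0 g_strict lxi xiC xi_cvg0 x2_cvg f2_sub.
have f1_cvg v : f1 n v @[n --> \oo] --> a v.
  have harm_v : harmonic n * `|v| @[n --> \oo] --> 0.
    by rewrite -[X in _ --> X](mul0r `|v|); apply: cvgMr_tmp; exact: cvg_harmonic.
  rewrite -[a v]subr0.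
  apply: (cvg_close (V := R^o) _ harm_v (cvgB (@an_cvg v) (@f2_cvg0 v))) => n.
  by rewrite !fctE opprB addrA; have [] := split_spec n.
split; first exact: lexx.
split; first exact: is_dual_epi_normal da.
exists (fun n => (x1 n, zs (g (x1 n)))), (fun n z => f1 n z.1 - z.2).
split; first by move=> n; exact: lexx.
split.
  have g_cont : {for wb, continuous g}.
    by apply: lipschitz_on_nbhs_continuous gL _; apply: nbhs_closed_ball_; rewrite subrr normr0.
  exact: cvg_pair x1_cvg (cvg_comp _ _ (cvg_comp _ _ x1_cvg g_cont) (@dzs.2 (g wb))).
split=> [n|v]; last by apply: cvgB (@f1_cvg v.1) (cvg_cst _).
apply: frechet_normal_norm_le (sum_norm_ge nW_ge (fun s => lexx _)) _.
exact: subgradient_frechet_normal_epi.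
Qed.

End ScalarizationRobustness.

(** * Scalarization and exact penalization *)

Section ConeInterior.
Variables (R : realType) (Z : normedModType R) (K : set Z).
Hypothesis cK : convex_cone K.

Lemma convex_cone_interiorD u v : K u -> interior K v -> interior K (u + v).
Proof.
move=> Ku /nbhs0P Kv; apply/nbhs0P; apply: filterS Kv => h Kvh.
by rewrite -addrA; exact: cK.2.2.
Qed.

Lemma convex_cone_interiorZ t v : 0 < t -> interior K v -> interior K (t *: v).
Proof.
move=> t0 /nbhs0P Kv; apply/nbhs0P.
have scale_cvg0 : t^-1 *: h @[h --> (0 : Z)] --> (0 : Z).
  by rewrite -[X in _ --> X](scaler0 Z t^-1); exact: scaler_continuous.
near=> h; have Kvh : K (v + t^-1 *: h) by near: h; exact: scale_cvg0 Kv.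
have -> : t *: v + h = t *: (v + t^-1 *: h) by rewrite scalerDr scalerA divff ?gt_eqF ?scale1r.
by apply: cK.2.1 => //; exact: ltW.
Unshelve. all: by end_near. Qed.

Lemma convex_cone_absorbing e : interior K e ->
  exists2 C, 0 < C & forall z, K ((C * `|z|) *: e - z).
Proof.
move=> /nbhs0P/nbhs_norm0P[d /= d0 Ke]; exists (2 / d) => [|z]; first by rewrite divr_gt0.
have [->|z0] := eqVneq z 0; first by rewrite normr0 mulr0 scale0r subr0; exact: cK.1.
have c0 : 0 < 2 / d * `|z| by rewrite mulr_gt0 ?divr_gt0 ?normr_gt0.
have -> : (2 / d * `|z|) *: e - z = (2 / d * `|z|) *: (e - (2 / d * `|z|)^-1 *: z).
  by rewrite scalerBr scalerA divff ?gt_eqF // scale1r.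
apply: cK.2.1; first exact: ltW.
apply: Ke; rewrite /= normrN normrZ gtr0_norm ?invr_gt0 // invfM mulfVK ?normr_eq0 //.
by rewrite invf_div ltr_pdivrMr //; lra.
Qed.

End ConeInterior.

Section Gerstewitz.
Variables (R : realType) (Z : normedModType R) (K : set Z) (e : Z).
Hypotheses (cK : convex_cone K) (Ke : interior K e) (nK0 : ~ interior K 0).

Definition gerstewitz (z : Z) : R := inf [set t | K (t *: e - z)].

Lemma gerstewitz_level_bounds : exists2 C, 0 < C &
  forall z, K ((C * `|z|) *: e - z) /\ forall t, K (t *: e - z) -> - (C * `|z|) <= t.
Proof.
have [C C0 KC] := convex_cone_absorbing cK Ke; exists C => // z; split=> // t Kt.
rewrite leNgt; apply/negP => t_lt; apply: nK0.
have a0 : 0 < - (t + C * `|z|) by lra.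
rewrite -(addNr ((- (t + C * `|z|)) *: e)).
apply: convex_cone_interiorD (convex_cone_interiorZ cK a0 Ke) => //.
have := cK.2.2 _ _ Kt (KC (- z)); rewrite opprK normrN addrACA addNr addr0 -scalerDl.
by rewrite -scaleNr opprK.
Qed.

Lemma gerstewitz_le z t : K (t *: e - z) -> gerstewitz z <= t.
Proof.
have [C _ /(_ z)[_ lb]] := gerstewitz_level_bounds.
by move=> Kt; apply: ge_inf => //; exists (- (C * `|z|)).
Qed.

Lemma le_gerstewitz z b : (forall t, K (t *: e - z) -> b <= t) -> b <= gerstewitz z.
Proof.
have [C _ /(_ z)[Kz _]] := gerstewitz_level_bounds.
by move=> lb; apply: lb_le_inf => //; exists (C * `|z|).
Qed.

Lemma gerstewitz_norm_dominated : exists2 C, 0 < C & norm_dominated C gerstewitz.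
Proof.
have [C C0 KC] := gerstewitz_level_bounds; exists C => // z.
by apply: gerstewitz_le; exact: (KC z).1.
Qed.

Lemma gerstewitz_sublinear : sublinear gerstewitz.
Proof.
apply: subadditive_sublinear => [|u v|t u t0].
- apply/eqP; rewrite eq_le gerstewitz_le /=; last by rewrite scale0r subr0; exact: cK.1.
  have [C _ /(_ 0)[_ lb]] := gerstewitz_level_bounds.
  by apply: le_gerstewitz => t /lb; rewrite normr0 mulr0 oppr0.
- rewrite -lerBlDr; apply: le_gerstewitz => t Kt.
  rewrite lerBlDr -lerBlDl; apply: le_gerstewitz => t' Kt'.
  rewrite lerBlDl; apply: gerstewitz_le; rewrite scalerDl opprD addrACA.
  exact: cK.2.2.
- rewrite mulrC -ler_pdivrMr //; apply: le_gerstewitz => b Kb.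
  rewrite ler_pdivrMr //; apply: gerstewitz_le; rewrite mulrC -scalerA -scalerBr.
  by apply: cK.2.1 => //; exact: ltW.
Qed.

Lemma gerstewitz_lt0_interior z : gerstewitz z < 0 -> interior K (- z).
Proof.
move=> s_lt0; have [t Kt t0] : exists2 t, K (t *: e - z) & t < 0.
  apply: contrapT => no; move: s_lt0; rewrite ltNge; apply/negP/negPn.
  by apply: le_gerstewitz => t Kt; rewrite leNgt; apply/negP => t0; apply: no; exists t.
have -> : - z = (t *: e - z) + (- t) *: e by rewrite scaleNr addrAC subrr add0r.
by apply: convex_cone_interiorD (convex_cone_interiorZ cK _ Ke) => //; rewrite oppr_gt0.
Qed.

Lemma gerstewitz_oppr_le0 z : K z -> gerstewitz (- z) <= 0.
Proof. by move=> Kz; apply: gerstewitz_le; rewrite scale0r add0r opprK. Qed.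

Lemma gerstewitz_scale t : gerstewitz (t *: e) <= t.
Proof. by apply: gerstewitz_le; rewrite subrr; exact: cK.1. Qed.

Lemma gerstewitz_minorant zs : is_dual zs -> (forall z, zs z <= gerstewitz z) ->
  dual_cone K zs /\ zs e = 1.
Proof.
move=> dzs zs_le; split.
  split=> // z Kz; rewrite -oppr_le0 -(linear_formN dzs.1).
  exact: le_trans (zs_le _) (gerstewitz_oppr_le0 Kz).
apply/eqP; rewrite eq_le; have := le_trans (zs_le _) (gerstewitz_scale 1).
have := le_trans (zs_le _) (gerstewitz_scale (-1)).
rewrite scale1r scaleN1r (linear_formN dzs.1) => zsN_le ->.
by move: zsN_le; lra.
Qed.

End Gerstewitz.

Lemma nbhs_closed_ball_sub (R : realType) (V : normedModType R) (x : V) (A : set V) :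
  nbhs x A -> exists2 r, 0 < r & closed_ball_ Num.norm x r `<=` A.
Proof. by move=> /nbhs_closedballP[r]; rewrite closed_ballE //; exists r%:num. Qed.

(* In terms of distances: [d(w, {q | 0 \in H q}) <= kappa d((w, 0), Gr H)] on [B]. *)
Definition error_bound_on (R : realType) (W Y : normedModType R) (B : set W) (kappa : R)
    (H : W -> set Y) : Prop :=
  forall w u y eps, B w -> H u y -> 0 < eps ->
  exists2 q, H q 0 & `|q - w| <= kappa * (`|w - u| + `|y|) + eps.

Section ExactPenalty.
Variables (R : realType) (W Y : normedModType R) (H : W -> set Y) (phi : W -> R).
Variables (wb : W) (r L kappa : R).
Hypotheses (r_ge0 : 0 <= r) (L_ge0 : 0 <= L).
Hypothesis phiL : L.-lipschitz_(closed_ball_ Num.norm wb r) (phi : W -> R^o).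
Hypothesis wb_min : forall q, closed_ball_ Num.norm wb r q -> H q 0 -> phi wb <= phi q.

Lemma lipschitz_exact_penalty w q : closed_ball_ Num.norm wb (r / 2) w -> H q 0 ->
  phi wb <= phi w + L * `|q - w|.
Proof.
rewrite /closed_ball_ /= => w_near Hq.
have phi_le u v : `|wb - u| <= r -> `|wb - v| <= r -> phi u <= phi v + L * `|u - v|.
  by move=> Bu Bv; have := @phiL (u, v) (conj Bu Bv); rewrite /= ler_norml; lra.
have w_r : `|wb - w| <= r by have := r_ge0; lra.
have [q_near|q_far] := leP `|q - w| `|wb - w|.
  have q_r : `|wb - q| <= r by have := ler_distD w wb q; rewrite [ `|w - q| ]distrC; lra.
  exact: le_trans (wb_min q_r Hq) (phi_le _ _ q_r w_r).
have wb_r : `|wb - wb| <= r by rewrite subrr normr0.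
apply: le_trans (phi_le _ _ wb_r w_r) _; rewrite lerD2l ler_wpM2l //; exact: ltW.
Qed.

Lemma error_bound_exact_penalty w u y :
  error_bound_on (closed_ball_ Num.norm wb (r / 2)) kappa H ->
  closed_ball_ Num.norm wb (r / 2) w -> H u y ->
  phi wb <= phi w + L * kappa * (`|w - u| + `|y|).
Proof.
move=> error_bound Bw Huy; apply/ler_addgt0Pr => eps eps0.
have L1_gt0 : 0 < L + 1 by rewrite ltr_wpDl.
have [q Hq q_w] := error_bound w u y _ Bw Huy (divr_gt0 eps0 L1_gt0).
apply: le_trans (lipschitz_exact_penalty Bw Hq) _; rewrite -addrA lerD2l.
apply: le_trans (ler_wpM2l L_ge0 q_w) _; rewrite mulrDr mulrA lerD2l.
by rewrite mulrA ler_pdivrMr // mulrC ler_pM2l // lerDl.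
Qed.

End ExactPenalty.

Lemma gerstewitz_exact_penalty (R : realType) (W Y Z : normedModType R) (K : set Z) (e : Z)
    (g : W -> Z) (H : W -> set Y) (wb w u : W) (y : Y) (r L C kappa : R) :
    convex_cone K -> interior K e -> ~ interior K 0 ->
    0 <= C -> norm_dominated C (gerstewitz K e) -> 0 <= r -> 0 <= L ->
    L.-lipschitz_(closed_ball_ Num.norm wb r) g ->
    (forall q, closed_ball_ Num.norm wb r q -> H q 0 -> ~ interior K (- (g q - g wb))) ->
    error_bound_on (closed_ball_ Num.norm wb (r / 2)) kappa H ->
    closed_ball_ Num.norm wb (r / 2) w -> H u y ->
  0 <= gerstewitz K e (g w - g wb) + C * L * kappa * (`|w - u| + `|y|).
Proof.
move=> cK Ke nK0 C0 sC r0 L0 gL weak_sol error_bound Bw Huy.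
have s_sub := gerstewitz_sublinear cK Ke nK0.
pose phi q := gerstewitz K e (g q - g wb).
have phi_wb : phi wb = 0 by rewrite /phi subrr (sublinear0 s_sub).
have phiL : (C * L).-lipschitz_(closed_ball_ Num.norm wb r) (phi : W -> R^o).
  apply: (lipschitz_sublinear_comp (g := fun q => g q - g wb) C0 s_sub sC).
  by move=> [a b] Bab; rewrite /= opprB addrA subrK; exact: gL (a, b) Bab.
have wb_min q : closed_ball_ Num.norm wb r q -> H q 0 -> phi wb <= phi q.
  move=> Bq Hq; rewrite phi_wb leNgt; apply/negP => /(gerstewitz_lt0_interior cK Ke nK0).
  exact: weak_sol.
rewrite -phi_wb.
exact: (error_bound_exact_penalty r0 (mulr_ge0 C0 L0) phiL wb_min error_bound Bw Huy).
Qed.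

(** * Limiting multipliers *)

Theorem limiting_multiplier_rule (R : realType) (V : completeNormedModType R)
    (A : set V) (N : V -> R) (C r : R) (xb : V) :
    asplund V -> closed A -> sublinear N -> norm_dominated C N -> 0 < r -> A xb ->
    (\forall h \near (0 : V), A (xb + h) -> 0 <= N h) ->
  exists (v : nat -> V) (xsn : nat -> V -> R) (xs : V -> R),
  [/\ v @ \oo --> xb /\ forall n, `|v n - xb| <= r,
      forall n, frechet_normal (@nrm R V) A (v n) (xsn n),
      exists D, 0 < D /\ forall n, norm_dominated D (xsn n),
      is_dual xs /\ forall h, xsn n h @[n --> \oo] --> xs h &
      forall h, - xs h <= N h].
Proof.
move=> aV clA sN NC r0 Axb N_min.
pose mu n := Num.min (harmonic n) r.
have mu0 n : 0 < mu n by rewrite lt_min harmonic_gt0.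
have mu_harm n : mu n <= harmonic n by rewrite ge_min lexx.
have /choice[v /choice[xsn v_spec]] n := fuzzy_multiplier_rule aV clA sN NC (mu0 n) Axb N_min.
have lxsn n : scalar (xsn n) by have [_ [_ [[]]]] := v_spec n.
have xsnC n : norm_dominated (`|C| + 1) (xsn n).
  apply: (norm_dominatedW (C := C + 1)) => [|h]; first by rewrite lerD2r ler_norm.
  have [_ _ /(_ (- h))] := v_spec n; rewrite (linear_formN (lxsn n)) opprK normrN.
  have harm1 : harmonic n <= 1 :> R by rewrite invf_le1 ?ler1n.
  have := ler_wpM2r (normr_ge0 h) (le_trans (mu_harm n) harm1).
  by have := NC (- h); rewrite normrN; lra.
have [phi [xs [phi_incr dxs xs_cvg]]] := weak_star_seq_compact lxsn xsnC aV.
have phi_oo := cvg_subsequence phi_incr.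
exists (v \o phi), (xsn \o phi), xs; split=> //.
- split=> [|n]; last first.
    by have [v_mu _ _] := v_spec (phi n); apply: le_trans v_mu _; rewrite ge_min lexx orbT.
  apply: cvg_comp phi_oo _; apply: (cvg_close _ cvg_harmonic (cvg_cst xb)) => n.
  by have [v_mu _ _] := v_spec n; exact: le_trans v_mu (mu_harm n).
- by move=> n; have [] := v_spec (phi n).
- by exists (`|C| + 1); split=> [|n]; [rewrite ltr_wpDl|exact: xsnC].
- move=> h; have harm_h : harmonic (phi n) * `|h| @[n --> \oo] --> 0.
    rewrite -[X in _ --> X](mul0r `|h|); apply: cvgMr_tmp.
    exact: cvg_comp phi_oo (@cvg_harmonic R).
  suff : - xs h - 0 <= N h by rewrite subr0.
  apply: cvgr_to_le (cvgB (cvgN (@xs_cvg h)) harm_h) _; apply: nearW => n.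
  have [_ _ /(_ h) xsN] := v_spec (phi n); rewrite !fctE lerBlDr.
  by apply: le_trans xsN _; rewrite lerD2l ler_wpM2r.
Qed.

Lemma graph_normal_scalarized_subgradient (R : realType) (W Z : normedModType R)
    (B : set W) (g : W -> Z) (L : R) z xs :
  L.-lipschitz_B g -> nbhs z.1 B -> frechet_normal (@nrm R (W * Z)%type) (graph_on B g) z xs ->
  frechet_subgradient ((fun y => - xs (0, y)) \o g) z.1 (fun h => xs (h, 0)).
Proof.
move=> gL zB /frechet_normal_nrmP[[_ z2] dxs xs_normal].
split=> [|eps eps0]; first exact: is_dual_inl.
have graph_near : \forall k \near (0 : W),
    graph_on B g (z.1 + k, z.2 + (g (z.1 + k) - g z.1)).
  by apply: filterS (iffLR (nbhs0P _ _) zB) => k Bk; split=> //=; rewrite z2 subrKC.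
apply: filterS (frechet_normal_ineq_graph xs_normal (lipschitz_near gL zB) graph_near eps0).
move=> k; rewrite (linear_form_pair _ _ dxs.1) (linear_formB (scalar_inr dxs.1)) /=.
by lra.
Qed.

Section PenalizedMultipliers.
Variables (R : realType) (W Z Y : completeNormedModType R).
Variables (nW : W -> R) (g : W -> Z) (H : W -> set Y) (wb : W) (s : Z -> R).
Variables (r L C D : R).
Hypotheses (aW : asplund W) (aZ : asplund Z) (aY : asplund Y).
Hypotheses (nW_ge : forall v, `|v| <= nW v) (r_gt0 : 0 < r) (L_gt0 : 0 < L).
Hypotheses (C_ge0 : 0 <= C) (D_ge0 : 0 <= D).
Hypotheses (clH : closed (graph H)) (Hwb : H wb 0).
Hypotheses (s_sub : sublinear s) (sC : norm_dominated C s).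

Local Notation B := (closed_ball_ Num.norm wb r).
Local Notation T := ((W * Z) * (W * Y))%type.

Hypothesis gL : L.-lipschitz_B g.
Hypothesis g_strict : strictly_lipschitz nW g wb.
Hypothesis wb_min : forall w u y, B w -> H u y ->
  0 <= s (g w - g wb) + D * (`|w - u| + `|y|).

Definition penalized_cost (h : T) : R := s h.1.2 + D * (`|h.1.1 - h.2.1| + `|h.2.2|).

Lemma penalized_cost_sublinear : sublinear penalized_cost.
Proof.
apply: sublinearD.
  exact: (sublinear_comp (snd \o fst : {linear T -> Z}) s_sub).
apply: sublinearZ D_ge0 _; apply: sublinearD; first exact: coupling_sublinear.
exact: (sublinear_comp (snd \o snd : {linear T -> Y}) (@norm_sublinear _ Y)).
Qed.

Lemma penalized_cost_dominated : norm_dominated (C + D * 3) penalized_cost.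
Proof.
move=> h; have h12_le := le_trans (prod_norm_snd h.1) (prod_norm_fst h).
have h22_le := le_trans (prod_norm_snd h.2) (prod_norm_snd h).
have D_le : D * (`|h.1.1 - h.2.1| + `|h.2.2|) <= D * (3 * `|h|).
  by apply: ler_wpM2l => //; have := coupling_le h; lra.
by have := sC h.1.2; have := ler_wpM2l C_ge0 h12_le; rewrite /penalized_cost; lra.
Qed.

Lemma penalized_cost_near_ge0 : \forall h \near (0 : T),
  (graph_on B g `*` graph H) ((wb, g wb, (wb, 0)) + h) -> 0 <= penalized_cost h.
Proof.
near=> h => -[[/= Bh gh] Hh]; have := wb_min Bh Hh.
rewrite /penalized_cost -gh /= add0r [g wb + _]addrC addrK.
by rewrite opprD addrACA subrr add0r.
Unshelve. all: by end_near. Qed.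

Section MultiplierSequences.
Variables (v : nat -> T) (xsn : nat -> T -> R) (xs : T -> R) (E : R).
Hypotheses (v_cvg : v @ \oo --> (wb, g wb, (wb, 0))).
Hypothesis v_near : forall n, `|v n - (wb, g wb, (wb, 0))| <= r / 2.
Hypothesis v_normal : forall n,
  frechet_normal (@nrm R T) (graph_on B g `*` graph H) (v n) (xsn n).
Hypotheses (E_gt0 : 0 < E) (xsnE : forall n, norm_dominated E (xsn n)).
Hypotheses (dxs : is_dual xs) (xs_cvg : forall h, xsn n h @[n --> \oo] --> xs h).

Let lxsn n : scalar (xsn n) := (v_normal n).2.1.1.

Lemma multiplier_limiting_subdiff :
  limiting_subdiff nW ((fun z => - xs (0, z, 0)) \o g) wb (fun h => xs (h, 0, 0)).
Proof.
have w_near n : `|(v n).1.1 - wb| <= r / 2.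
  by have := v_near n; rewrite !prod_norm_le /= => /andP[/andP[]].
apply: (@scalarized_limiting_subdiff _ _ _ nW g wb r L E aW nW_ge r_gt0 L_gt0 E_gt0
  gL g_strict (fun n z => - xsn n (0, z, 0)) _ (fun n => (v n).1.1)
  (fun n h => xsn n (h, 0, 0))).
- by move=> n t u u'; rewrite (scalar_inr (scalar_inl (lxsn n))) /GRing.scale /=; ring.
- move=> n z; rewrite -(linear_formN (lxsn n)); apply: le_trans (xsnE n _) _.
  by rewrite normrN prod_norm_inl prod_norm_inr.
- exact: (is_dualN (is_dual_inr (is_dual_inl dxs))).
- by move=> z; apply: cvgN; exact: xs_cvg.
- exact: w_near.
- exact: cvg_comp _ _ (cvg_comp _ _ v_cvg cvg_fst) cvg_fst.
- move=> n; have [g_normal _] := frechet_normal_prod (v_normal n).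
  apply: graph_normal_scalarized_subgradient gL _ g_normal.
  by apply: nbhs_closed_ball_; apply: le_lt_trans (w_near n) _; have := r_gt0; lra.
- exact: (is_dual_inl (is_dual_inl dxs)).
- by move=> h; exact: xs_cvg.
Qed.

Lemma multiplier_normal_coderiv :
  normal_coderiv nW (@nrm R Y) H wb 0 (fun y => - xs (0, (0, y))) (fun h => xs (0, (h, 0))).
Proof.
split; [exact: Hwb|split].
  exact: (is_dual_pair (is_dual_inl (is_dual_inr dxs))
    (is_dualN (is_dualN (is_dual_inr (is_dual_inr dxs))))).
exists (fun n => (v n).2), (fun n z => xsn n (0, z)).
have v_normal2 n := (frechet_normal_prod (v_normal n)).2.
split; first by move=> n; exact: (v_normal2 n).1.
split; first exact: cvg_comp _ _ v_cvg cvg_snd.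
split=> [n|z].
  by apply: frechet_normal_norm_le (v_normal2 n); exact: sum_norm_ge.
by rewrite opprK -(linear_form_pair _ _ (scalar_inr dxs.1)) -surjective_pairing; exact: xs_cvg.
Qed.

End MultiplierSequences.

Theorem penalized_multipliers :
  exists (zs : Z -> R) (ys : Y -> R) (a b : W -> R),
  [/\ is_dual zs /\ forall z, zs z <= s z, is_dual ys,
      limiting_subdiff nW (zs \o g) wb a,
      normal_coderiv nW (@nrm R Y) H wb 0 ys b & forall w, a w + b w = 0].
Proof.
have aT : asplund T := asplund_prod (asplund_prod aW aZ) (asplund_prod aW aY).
have clA := closed_setX (graph_on_closed (closed_closed_ball_ (x := wb) (e := r)) gL) clH.
have Bwb : B wb by rewrite /closed_ball_ /= subrr normr0 ltW.
have r2_gt0 : 0 < r / 2 by rewrite divr_gt0.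
have [|v [xsn [xs [[v_cvg v_near] v_normal [E [E0 xsnE]] [dxs xs_cvg] xs_le]]]] :=
  limiting_multiplier_rule (xb := (wb, g wb, (wb, 0)) : T) aT clA penalized_cost_sublinear
    penalized_cost_dominated r2_gt0 _ penalized_cost_near_ge0; first by split.
exists (fun z => - xs (0, z, 0)), (fun y => - xs (0, (0, y))), (fun h => xs (h, 0, 0)),
  (fun h => xs (0, (h, 0))); split.
- split=> [|z]; first exact: (is_dualN (is_dual_inr (is_dual_inl dxs))).
  by have := xs_le (0, z, 0); rewrite /penalized_cost /= subrr !normr0 addr0 mulr0 addr0.
- exact: (is_dualN (is_dual_inr (is_dual_inr dxs))).
- exact: multiplier_limiting_subdiff v_cvg v_near v_normal E0 xsnE dxs xs_cvg.
- exact: multiplier_normal_coderiv v_cvg v_normal dxs xs_cvg.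
have sum_ge w : - (xs (w, 0, 0) + xs (0, (w, 0))) <= 0.
  have := xs_le (w, 0, (w, 0)); rewrite (linear_form_pair _ _ dxs.1) /penalized_cost /=.
  by rewrite subrr !normr0 addr0 mulr0 addr0 (sublinear0 s_sub).
move=> w; apply/eqP; rewrite eq_le; have := sum_ge w; have := sum_ge (- w).
rewrite (linear_formN (scalar_inl (scalar_inl dxs.1))).
rewrite (linear_formN (scalar_inl (scalar_inr dxs.1))).
by move=> le_0 ge_0; apply/andP; split; lra.
Qed.

End PenalizedMultipliers.

Theorem weak_solution_multipliers (R : realType) (W Z Y : completeNormedModType R)
    (nW : W -> R) (K : set Z) (e : Z) (g : W -> Z) (H : W -> set Y) (wb : W) (r L kappa : R) :
    asplund W -> asplund Z -> asplund Y -> (forall v, `|v| <= nW v) ->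
    convex_cone K -> interior K e -> 0 < r -> 0 < L -> 0 <= kappa ->
    L.-lipschitz_(closed_ball_ Num.norm wb r) g -> strictly_lipschitz nW g wb ->
    closed (graph H) -> H wb 0 ->
    (forall q, closed_ball_ Num.norm wb r q -> H q 0 -> ~ interior K (- (g q - g wb))) ->
    error_bound_on (closed_ball_ Num.norm wb (r / 2)) kappa H ->
  exists (zs : Z -> R) (ys : Y -> R) (a b : W -> R),
  [/\ dual_cone K zs /\ zs e = 1, is_dual ys, limiting_subdiff nW (zs \o g) wb a,
      normal_coderiv nW (@nrm R Y) H wb 0 ys b & forall w, a w + b w = 0].
Proof.
move=> aW aZ aY nW_ge cK Ke r0 L0 kappa0 gL g_strict clH Hwb weak_sol error_bound.
have Bwb : closed_ball_ Num.norm wb r wb by rewrite /closed_ball_ /= subrr normr0 ltW.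
have nK0 : ~ interior K 0 by have := weak_sol wb Bwb Hwb; rewrite subrr oppr0.
have [C C0 sC] := gerstewitz_norm_dominated cK Ke nK0.
have r2_gt0 : 0 < r / 2 by rewrite divr_gt0.
have half_sub : closed_ball_ Num.norm wb (r / 2) `<=` closed_ball_ Num.norm wb r.
  by apply: closed_ball_sub_center; rewrite subrr normr0; lra.
have penalty w u y := @gerstewitz_exact_penalty R W Y Z K e g H wb w u y r L C kappa
  cK Ke nK0 (ltW C0) sC (ltW r0) (ltW L0) gL weak_sol error_bound.
have D0 : 0 <= C * L * kappa by rewrite !mulr_ge0 // ltW.
have [zs [ys [a [b [[dzs zs_le] dys a_sub b_cod ab0]]]]] :=
  penalized_multipliers aW aZ aY nW_ge r2_gt0 L0 (ltW C0) D0 clH Hwb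
    (gerstewitz_sublinear cK Ke nK0) sC (lipschitz_onS half_sub gL) g_strict penalty.
by exists zs, ys, a, b; split=> //; exact: (gerstewitz_minorant cK Ke nK0 dzs zs_le).
Qed.

Section SumNormProducts.
Variables (R : realType) (X P : normedModType R).

Lemma sum_norm_lipschitz (Z : normedModType R) (g : X * P -> Z) (L : R) (N : set (X * P)) :
  0 <= L -> (forall a b, N a -> N b -> `|g a - g b| <= L * (`|a.1 - b.1| + `|a.2 - b.2|)) ->
  (2 * L).-lipschitz_N g.
Proof.
move=> L0 gL [a b] [Na Nb] /=; apply: le_trans (gL a b Na Nb) _.
rewrite [2 * L]mulrC -mulrA; apply: ler_wpM2l => //.
by have := prod_norm_fst (a - b); have := prod_norm_snd (a - b); rewrite /=; lra.
Qed.

Lemma dist_graph_error_bound (Y : normedModType R) (H : X * P -> set Y) (kappa eps : R)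
    (w u : X * P) y : 0 < kappa ->
  (dist (sum_norm (@nrm R P) (@nrm R X)) (w.2, w.1) [set q | H (q.2, q.1) 0%R]
   <= kappa%:E * dist (sum_norm (sum_norm (@nrm R X) (@nrm R P)) (@nrm R Y))
                   (w, 0%R) (graph H))%E ->
  H u y -> 0 < eps ->
  exists2 q, H q 0 & `|q - w| <= 2 * kappa * (`|w - u| + `|y|) + eps.
Proof.
move=> kappa0 error_bound Huy eps0.
set bound := _ + eps.
have : (dist (sum_norm (@nrm R P) (@nrm R X)) (w.2, w.1) [set q | H (q.2, q.1) 0%R]
    < bound%:E)%E.
  apply: le_lt_trans error_bound _.
  apply: (@le_lt_trans _ _ (kappa * (`|w.1 - u.1| + `|w.2 - u.2| + `|y|))%:E).
    rewrite EFinM lee_pmul2l ?lte_fin // ?fin_numE //; apply: ereal_inf_lbound.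
    by exists (u, y) => //; rewrite /sum_norm /nrm /= sub0r normrN.
  rewrite lte_fin /bound; apply: ltr_pwDr => //.
  rewrite [2 * _]mulrC -mulrA; apply: ler_wpM2l; first exact: ltW.
  have := prod_norm_fst (w - u); have := prod_norm_snd (w - u); rewrite /=.
  by have := normr_ge0 y; lra.
move=> /ereal_inf_lt[_ [[p x] Hxp <-]]; rewrite lte_fin /sum_norm /nrm /= => dist_lt.
exists (x, p) => //; apply: le_trans (prod_norm_le_add _) _ => /=.
by rewrite addrC distrC [ `|x - _| ]distrC ltW.
Qed.

End SumNormProducts.

Unset Implicit Arguments.

Theorem theorem4p3 (R : realType) (X Y Z P : completeNormedModType R)
  (K : set Z) (g : X * P -> Z) (H : X * P -> set Y) (xb : X) (pb : P) (L : R) :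
  asplund X -> asplund Y -> asplund Z -> asplund P ->
  closed K -> convex_cone K -> pointed K -> interior K !=set0 ->
  closed (graph H) ->
  0 < L ->
  (* (1) g is L-strictly Lipschitz at (xb, pb) *)
  strictly_lipschitz (sum_norm (@nrm R X) (@nrm R P)) g (xb, pb) ->
  (exists N : set (X * P), nbhs (xb, pb) N /\
     forall a b, N a -> N b ->
       `|g a - g b| <= L * (`|a.1 - b.1| + `|a.2 - b.2|)) ->
  (* (2) local weak solution *)
  H (xb, pb) 0 ->
  (exists (U : set X) (W : set P), nbhs xb U /\ nbhs pb W /\
     forall x p, U x -> W p -> H (x, p) 0 ->
       ~ interior K (- (g (x, p) - g (xb, pb)))) ->
  (* (3) metric-type estimate *)
  (exists r : R, 0 < r /\ exists N : set (X * P), nbhs (xb, pb) N /\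
     forall x p, N (x, p) ->
       (dist (sum_norm (@nrm R P) (@nrm R X)) (p, x)
            [set q : P * X | H (q.2, q.1) (0%R : Y)]
       <= r%:E * dist (sum_norm (sum_norm (@nrm R X) (@nrm R P)) (@nrm R Y))
                      ((x, p), (0%R : Y)) (graph H))%E) ->
  forall e, interior K e ->
  exists zs : Z -> R, dual_cone K zs /\ zs e = 1 /\
  exists ys : Y -> R, is_dual ys /\
  exists a b : X * P -> R,
    limiting_subdiff (sum_norm (@nrm R X) (@nrm R P)) (zs \o g) (xb, pb) a /\
    normal_coderiv (sum_norm (@nrm R X) (@nrm R P)) (@nrm R Y) H (xb, pb) 0 ys b /\
    forall w, a w + b w = 0.
Proof.
move=> aX aY aZ aP _ cK _ _ clH L0 g_strict [N1 [N1_nbhs gL]] H0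
  [U [V [U_nbhs [V_nbhs weak_sol]]]] [kappa [kappa0 [N2 [N2_nbhs metric]]]] e Ke.
have UV_nbhs : nbhs (xb, pb) (U `*` V) by exists (U, V).
have [r r0 ball_sub] :=
  nbhs_closed_ball_sub (filterI (filterI N1_nbhs UV_nbhs) N2_nbhs).
have gB : (2 * L).-lipschitz_(closed_ball_ Num.norm (xb, pb) r) g.
  by apply: lipschitz_onS (sum_norm_lipschitz (ltW L0) gL) => w /ball_sub[[]].
have error_bound : error_bound_on (closed_ball_ Num.norm (xb, pb) (r / 2)) (2 * kappa) H.
  move=> [x p] u y eps Bxp; apply: dist_graph_error_bound kappa0 (metric _ _ _).
  apply: (ball_sub _ _).2; apply: closed_ball_sub_center Bxp.
  by rewrite subrr normr0; lra.
have [|zs [ys [a [b [[zsK zse] dys a_sub b_cod ab0]]]]] :=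
  weak_solution_multipliers (asplund_prod aX aP) aZ aY
    (sum_norm_ge (fun _ => lexx _) (fun _ => lexx _)) cK Ke r0 (mulr_gt0 (ltr0n _ 2) L0)
    (ltW (mulr_gt0 (ltr0n _ 2) kappa0)) gB g_strict clH H0 _ error_bound.
  by move=> [x p] /ball_sub[[_ [Ux Vp]] _]; exact: weak_sol.
by exists zs; split=> //; split=> //; exists ys; split=> //; exists a, b.
Qed.
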